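(* Galilean covariance of the wave equation and the de Broglie wave-particle duality hypothesis (both as defined in the context) imply the Schrödinger equation: for a particle of mass $m$ with potential energy $V$, the only linear wave equation $$a^{\mu\nu}\partial_\mu\partial_\nu\Psi+b^\mu\partial_\mu\Psi+f\,\Psi=0$$ satisfying both the de Broglie hypothesis and Galilean covariance is, up to an overall constant factor, the Schrödinger equation $$i\hbar\frac{\partial\Psi}{\partial t}=-\frac{\hbar^2}{2m}\nabla^2\Psi+V\Psi ,$$ where $V=0$ for a free particle and, in general, $V$ may depend on position and time. Moreover, the same assumptions determine the transformation law of the wave function under a Galilean boost with velocity $\mathbf v$, $v=|\mathbf v|$, namely $\Psi(\mathbf r,t)=g(\mathbf r',t')\Psi'(\mathbf r',t')$ with $$g(\mathbf r',t')=\exp\left[\frac{i}{\hbar}\left(\frac{mv^2}{2}t'+m\,\mathbf v\cdot\mathbf r'\right)\right].$$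
   Context: Notation: $x^0=ct$, $(x^1,x^2,x^3)=\mathbf r=(x,y,z)$, $\partial_\mu=\partial/\partial x^\mu$, $\mu=0,1,2,3$, repeated indices are summed; $c$ is the speed of light in vacuum and $\hbar$ the reduced Planck constant. Wave equation: the most general homogeneous linear partial differential equation in $x,y,z,t$ of order at most two with constant coefficients $a^{\mu\nu},b^\mu$ multiplying the derivatives and an arbitrary function $f(\mathbf r,t)$ multiplying $\Psi$. It must provide solutions that propagate waves along spacetime, especially for free particles with nonzero momentum; an equation without time derivatives is not a wave equation. Frames: a rotation relates inertial frames $S$ and $S'$ by $\mathbf r'=M\mathbf r$, $t'=t$, $M\in SO(3)$; a Galilean boost with velocity $\mathbf v$ relates them by $t=t'$, $\mathbf r=\mathbf r'+\mathbf v t'$. The function $f$ is a strict scalar: $f(\mathbf r,t)=f'(\mathbf r',t')$ after a rotation or a boost. Under rotations $\Psi(\mathbf r,t)=\Psi'(\mathbf r',t)$; under a boost $\Psi(\mathbf r,t)=g(\mathbf r',t')\Psi'(\mathbf r',t')$ with $g$ an arbitrary nonvanishing function, to be determined. Galilean covariance: if $S'$ is connected to $S$ by a spatial rotation or a Galilean boost and the wave equation holds in $S$, then in $S'$ it reads, up to an overall nonzero multiplicative factor, $a^{\mu\nu}\partial_{\mu'}\partial_{\nu'}\Psi'+b^\mu\partial_{\mu'}\Psi'+f'\Psi'=0$ with the same constants $a^{\mu\nu},b^\mu$. De Broglie hypothesis: a massive particle has an associated wave function, and its energy and momentum are $E=\hbar\omega$, $\mathbf p=\hbar\mathbf k$,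 with $\omega$ the angular frequency and $\mathbf k$ the wave vector of that wave. It is used by requiring that plane wave solutions $\Psi_0e^{i(\mathbf k\cdot\mathbf r-\omega t)}$ obey the dispersion relation obtained from the non-relativistic energy: $\omega=\hbar k^2/(2m)$, $k=|\mathbf k|$, for a free particle, and $\omega=\hbar k^2/(2m)+V/\hbar$ for a particle in a constant potential $V$; the value of $f$ so found for constant $V$ is then generalized to a position and time dependent potential $V$.
   Formalization: The boost factor g is determined only up to a nonzero constant factor (any constant multiple also works), and the de Broglie hypothesis is taken to include that a plane wave solution exists for every nonzero wave vector in every constant potential; otherwise the claim fails. *)

(* Defs.v *)
From HB Require Import structures.
From mathcomp Require Import all_boot all_order all_algebra.
From mathcomp Require Import complex.
From mathcomp Require Import all_classical all_reals all_analysis.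

Set Implicit Arguments.
Unset Strict Implicit.
Unset Printing Implicit Defensive.

Import Order.TTheory GRing.Theory Num.Theory.
Import numFieldNormedType.Exports.

Local Open Scope ring_scope.
Local Open Scope complex_scope.

(* The coordinates of an event are x^0 = ct, (x^1, x^2, x^3) = r. *)
Definition event (R : realType) := 'cV[R]_(1 + 3).

Definition etime (R : realType) (c : R) (x : event R) : R := x ord0 ord0 / c.

Definition epos (R : realType) (x : event R) : 'cV[R]_3 := dsubmx x.

Definition dot (R : realType) (u v : 'cV[R]_3) : R :=
  \sum_(i < 3) u i ord0 * v i ord0.

Definition expi (R : realType) (theta : R) : R[i] :=
  cos theta +i* sin theta.

(* R[i] carries no normed R-module structure in the library, so
   complex-valued functions of an event are differentiated componentwise. *)
Definition rpd (R : realType) (mu : 'I_(1 + 3)) (u : event R -> R) :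
    event R -> R :=
  fun x => 'D_(delta_mx mu ord0 : event R) u x.

Definition pd (R : realType) (mu : 'I_(1 + 3)) (Psi : event R -> R[i]) :
    event R -> R[i] :=
  fun x => rpd mu (fun y => complex.Re (Psi y)) x
        +i* rpd mu (fun y => complex.Im (Psi y)) x.

Definition rC2 (R : realType) (u : event R -> R) : Prop :=
  (forall x, differentiable u x) /\
  forall mu, (forall x, differentiable (rpd mu u) x) /\
    forall nu, continuous (rpd nu (rpd mu u)).

Definition C2 (R : realType) (Psi : event R -> R[i]) : Prop :=
  rC2 (fun x => complex.Re (Psi x)) /\ rC2 (fun x => complex.Im (Psi x)).

Definition waveop (R : realType) (a : 'M[R[i]]_(1 + 3)) (b : 'cV[R[i]]_(1 + 3))
    (f Psi : event R -> R[i]) (x : event R) : R[i] :=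
  \sum_mu \sum_nu a mu nu * pd mu (pd nu Psi) x
  + \sum_mu b mu ord0 * pd mu Psi x
  + f x * Psi x.

(* d/dt = c d/dx^0, since x^0 = ct *)
Definition dt (R : realType) (c : R) (Psi : event R -> R[i]) (x : event R) :
    R[i] :=
  c%:C * pd ord0 Psi x.

Definition laplacian (R : realType) (Psi : event R -> R[i]) (x : event R) :
    R[i] :=
  \sum_(i < 3) pd (rshift 1 i) (pd (rshift 1 i) Psi) x.

Definition schrodinger_lhs (R : realType) (c hbar : R) (Psi : event R -> R[i])
    (x : event R) : R[i] :=
  (0 +i* 1) * hbar%:C * dt c Psi x.

Definition schrodinger_rhs (R : realType) (hbar m : R) (V : event R -> R)
    (Psi : event R -> R[i]) (x : event R) : R[i] :=
  - (hbar ^+ 2 / (2 * m))%:C * laplacian Psi x + (V x)%:C * Psi x.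

Definition plane_wave (R : realType) (c : R) (Psi0 : R[i]) (k : 'cV[R]_3)
    (omega : R) (x : event R) : R[i] :=
  Psi0 * expi (dot k (epos x) - omega * etime c x).

Definition plane_wave_solution (R : realType) (c : R) (a : 'M[R[i]]_(1 + 3))
    (b : 'cV[R[i]]_(1 + 3)) (f : event R -> R[i])
    (Psi0 : R[i]) (k : 'cV[R]_3) (omega : R) : Prop :=
  forall x, waveop a b f (plane_wave c Psi0 k omega) x = 0.

(* From here on, f assigns to every potential energy V the function f V
   multiplying Psi in the wave equation of a particle in that potential; the
   coefficients a and b do not depend on V. *)

(* Only the symmetric part of a acts on C2 functions, so time derivatives are
   absent exactly when the symmetrized a^(0 mu) and b^0 all vanish. *)
Definition is_wave_equation (R : realType) (c : R) (a : 'M[R[i]]_(1 + 3))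
    (b : 'cV[R[i]]_(1 + 3)) (f : (event R -> R) -> event R -> R[i]) : Prop :=
  ((exists mu, a ord0 mu + a mu ord0 != 0) \/ b ord0 ord0 != 0) /\
  (exists (Psi0 : R[i]) (k : 'cV[R]_3) (omega : R),
     [/\ Psi0 != 0, k != 0, omega != 0 &
         plane_wave_solution c a b (f (fun=> 0)) Psi0 k omega]).

(* x are the coordinates in S, x' those of the same event in S'. *)
Definition rotation_frames (R : realType) (c : R) (M : 'M[R]_3)
    (x x' : event R) : Prop :=
  epos x' = M *m epos x /\ etime c x' = etime c x.

Definition boost_frames (R : realType) (c : R) (v : 'cV[R]_3)
    (x x' : event R) : Prop :=
  etime c x = etime c x' /\ epos x = epos x' + etime c x' *: v.

Definition is_rotation (R : realType) (M : 'M[R]_3) : Prop :=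
  M^T *m M = 1%:M /\ \det M = 1.

(* Substituting Psi = g Psi' (with f a strict scalar) turns the left-hand side
   of the equation in S into that of the equation in S' with the same a and b,
   up to a factor lam that vanishes nowhere. *)
Definition form_invariant (R : realType) (frames : event R -> event R -> Prop)
    (g : event R -> R[i]) (a : 'M[R[i]]_(1 + 3)) (b : 'cV[R[i]]_(1 + 3))
    (f : event R -> R[i]) : Prop :=
  exists lam : event R -> R[i],
    (forall x', lam x' != 0) /\
    forall f' Psi Psi' : event R -> R[i], C2 Psi' ->
      (forall x x', frames x x' -> f x = f' x') ->
      (forall x x', frames x x' -> Psi x = g x' * Psi' x') ->
      forall x x', frames x x' ->
        waveop a b f Psi x = lam x' * waveop a b f' Psi' x'.

Definition boost_law (R : realType) (c : R) (a : 'M[R[i]]_(1 + 3))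
    (b : 'cV[R[i]]_(1 + 3)) (f : event R -> R[i]) (v : 'cV[R]_3)
    (g : event R -> R[i]) : Prop :=
  [/\ forall x', g x' != 0, C2 g &
      form_invariant (boost_frames c v) g a b f].

Definition galilean_covariant (R : realType) (c : R) (a : 'M[R[i]]_(1 + 3))
    (b : 'cV[R[i]]_(1 + 3)) (f : event R -> R[i]) : Prop :=
  (forall M : 'M[R]_3, is_rotation M ->
     form_invariant (rotation_frames c M) (fun=> 1) a b f) /\
  (forall v : 'cV[R]_3, exists g, boost_law c a b f v g).

(* The three clauses: a particle of nonzero momentum hbar k in a constant
   potential V0 has an associated plane wave; energy and momentum of every
   plane wave obey hbar omega = |hbar k|^2 / (2 m) + V0; and the value of f
   at an event, for an arbitrary V, is the one found for the constant
   potential equal to the value of V there. *)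
Definition de_broglie (R : realType) (c hbar m : R) (a : 'M[R[i]]_(1 + 3))
    (b : 'cV[R[i]]_(1 + 3)) (f : (event R -> R) -> event R -> R[i]) : Prop :=
  [/\ forall (V0 : R) (k : 'cV[R]_3), k != 0 ->
        exists (Psi0 : R[i]) (omega : R), Psi0 != 0 /\
          plane_wave_solution c a b (f (fun=> V0)) Psi0 k omega,
      forall (V0 : R) (Psi0 : R[i]) (k : 'cV[R]_3) (omega : R), Psi0 != 0 ->
        plane_wave_solution c a b (f (fun=> V0)) Psi0 k omega ->
        omega = hbar * dot k k / (2 * m) + V0 / hbar
    & forall (V : event R -> R) (x : event R), f V x = f (fun=> V x) x].

Definition boost_factor (R : realType) (c hbar m : R) (v : 'cV[R]_3)
    (x' : event R) : R[i] :=
  expi (hbar^-1 *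
        (m * dot v v / 2 * etime c x' + m * dot v (epos x'))).

(* Main.v *)
(** By the de Broglie hypothesis the plane wave of wave vector [k] and frequency
    [hbar k^2 / (2 m) + V0 / hbar] solves the equation for the constant
    potential [V0].  Along [k = s u] this is a polynomial identity of degree four
    in [s], whose coefficients force [a^(00) = 0], [a^(0i) + a^(i0) = 0],
    [b^i = 0], [a^(ij) + a^(ji)] to be a fixed multiple of [b^0 delta_ij], and
    [f] to be a multiple of [V]; what is left is the Schroedinger equation.

    A boost turns the free operator applied to [g Psi'] into [g] times the free
    operator of [Psi'], plus a zeroth order term in [Psi'] (the drift of [g]) and
    first order terms in [grad Psi'] (the shears of [g]).  Testing form invariance
    on [1], [x^0] and [x^j] shows that the factor [lam] equals [g] and that drift
    and shears vanish.  These conditions prescribe the logarithmic gradient of [g],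
    so [g] is a constant multiple of the plane wave [boost_factor]; conversely
    that plane wave kills drift and shears. *)

Require Import Defs.
From HB Require Import structures.
From mathcomp Require Import all_boot all_order all_algebra.
From mathcomp Require Import complex ring.
From mathcomp Require Import all_classical all_reals all_analysis.

Set Implicit Arguments.
Unset Strict Implicit.
Unset Printing Implicit Defensive.

Import Order.TTheory GRing.Theory Num.Theory.
Import numFieldNormedType.Exports.

Local Open Scope ring_scope.
Local Open Scope complex_scope.

Local Notation iC := (0 +i* 1).

(** * Real functions of an event *)

(** An intermediate class: [rC2 u] amounts to differentiability of [u] together with [rC1] for each
    [rpd mu u], so closure properties of [rC2] follow from those of [rC1]. *)
Definition rC1 (R : realType) (u : event R -> R) : Prop :=
  (forall x, differentiable u x) /\ forall nu, continuous (rpd nu u).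

Lemma rC2_rC1 (R : realType) (u : event R -> R) : rC2 u -> rC1 u.
Proof.
move=> [du d2]; split=> // nu x.
exact/differentiable_continuous/(d2 nu).1.
Qed.

Lemma rC2_rpd (R : realType) (u : event R -> R) mu : rC2 u -> rC1 (rpd mu u).
Proof. by move=> [du d2]; exact: d2. Qed.

(** * Rules for partial derivatives of real functions *)

Lemma rpd_cst (R : realType) mu (k : R) : rpd mu (fun=> k) = fun=> 0.
Proof. by apply/funext => x; rewrite /rpd derive_cst. Qed.

Lemma rpdD (R : realType) mu (u w : event R -> R) :
  (forall x, differentiable u x) -> (forall x, differentiable w x) ->
  rpd mu (fun x => u x + w x) = fun x => rpd mu u x + rpd mu w x.
Proof.
move=> du dw; apply/funext => x; rewrite /rpd.
by rewrite [LHS](@deriveD _ _ _ u w)//; exact: diff_derivable.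
Qed.

Lemma rpdB (R : realType) mu (u w : event R -> R) :
  (forall x, differentiable u x) -> (forall x, differentiable w x) ->
  rpd mu (fun x => u x - w x) = fun x => rpd mu u x - rpd mu w x.
Proof.
move=> du dw; apply/funext => x; rewrite /rpd.
by rewrite [LHS](@deriveB _ _ _ u w)//; exact: diff_derivable.
Qed.

Lemma rpdM (R : realType) mu (u w : event R -> R) :
  (forall x, differentiable u x) -> (forall x, differentiable w x) ->
  rpd mu (fun x => u x * w x) = fun x => u x * rpd mu w x + rpd mu u x * w x.
Proof.
move=> du dw; apply/funext => x; rewrite /rpd.
rewrite [LHS](@deriveM _ _ u w)//; try exact: diff_derivable.
by rewrite [w x *: _]mulrC.
Qed.

Lemma rpd_coord (R : realType) mu nu :
  rpd mu (fun x : event R => x nu ord0) = fun=> (nu == mu)%:R.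
Proof.
apply/funext => x; rewrite /rpd deriveE; last exact: differentiable_coord.
have @l : {linear event R -> R}.
  by exists (fun N : event R => N nu ord0); do 2![eexists]; do ?[constructor];
     rewrite ?mxE// => ? *; rewrite ?mxE//; move=> ?; rewrite !mxE.
rewrite (_ : (fun _ => _) = l) // diff_lin; last exact: coord_continuous.
by rewrite /= mxE eqxx andbT.
Qed.

Lemma derive_sum_rpd (R : realType) (u : event R -> R) (x e : event R) :
  differentiable u x -> 'D_e u x = \sum_nu e nu ord0 * rpd nu u x.
Proof.
move=> du; rewrite deriveE// [e in LHS]matrix_sum_delta linear_sum.
apply: eq_bigr => nu _; rewrite big_ord1 linearZ/=.
by rewrite /rpd deriveE// ord1.
Qed.

Lemma differentiable_mulmx (R : realType) (L : 'M[R]_(1 + 3)) (x : event R) :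
  differentiable (fun y : event R => L *m y : event R) x.
Proof.
(* The product is a combination of the columns of [L] with the coordinates of [y] as
   coefficients. *)
rewrite (_ : (fun y : event R => _) =
  \sum_(j < 1 + 3) (fun y : event R => y j ord0 *: (col j L : event R))).
  apply: differentiable_sum => j.
  exact/differentiableZl/differentiable_coord.
apply/funext => y; rewrite fct_sumE; apply/colP => i.
rewrite mxE summxE; apply: eq_bigr => j _.
by rewrite !mxE mulrC.
Qed.

Lemma differentiable_comp_mulmx (R : realType) (L : 'M[R]_(1 + 3))
    (u : event R -> R) :
  (forall x, differentiable u x) ->
  forall x, differentiable (fun y : event R => u (L *m y)) x.
Proof.
move=> du x.
apply: (@differentiable_comp _ _ _ _ (fun y : event R => L *m y : event R) u) => //.
exact: differentiable_mulmx.
Qed.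

Lemma rpd_comp_mulmx (R : realType) (L : 'M[R]_(1 + 3))
    (u : event R -> R) mu :
  (forall x, differentiable u x) ->
  rpd mu (fun y => u (L *m y)) =
  fun x => \sum_nu L nu mu * rpd nu u (L *m x).
Proof.
move=> du; apply/funext => x.
(* By linearity of [L] both sides are limits of the same difference quotient, so the chain rule
   reduces to expanding one directional derivative. *)
have -> : rpd mu (fun y => u (L *m y)) x = 'D_(L *m delta_mx mu ord0) u (L *m x).
  rewrite /rpd /derive.
  apply: (congr1 (fun F : R -> R^o => lim (F @ 0^')%classic)); apply/funext => h /=.
  by rewrite mulmxDr -scalemxAr.
rewrite derive_sum_rpd//; apply: eq_bigr => nu _; congr (_ * _).
by rewrite -colE mxE.
Qed.

(** * Closure of the C1 and C2 classes under algebra and linear substitution *)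

Lemma econtinuousD (R : realType) (u w : event R -> R) :
  continuous u -> continuous w -> continuous (fun x => u x + w x).
Proof. by move=> cu cw x; exact: (@continuousD _ _ _ u w x (cu x) (cw x)). Qed.

Lemma econtinuousB (R : realType) (u w : event R -> R) :
  continuous u -> continuous w -> continuous (fun x => u x - w x).
Proof. by move=> cu cw x; exact: (@continuousB _ _ _ u w x (cu x) (cw x)). Qed.

Lemma econtinuousM (R : realType) (u w : event R -> R) :
  continuous u -> continuous w -> continuous (fun x => u x * w x).
Proof. by move=> cu cw x; exact: (@continuousM _ _ u w x (cu x) (cw x)). Qed.

Lemma differentiable_econtinuous (R : realType) (u : event R -> R) :
  (forall x, differentiable u x) -> continuous u.
Proof. by move=> du x; exact: differentiable_continuous. Qed.

Lemma rC1_cst (R : realType) (k : R) : rC1 (fun=> k).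
Proof.
split=> [x|nu]; first exact: differentiable_cst.
by rewrite rpd_cst; exact: cst_continuous.
Qed.

Lemma rC1D (R : realType) (u w : event R -> R) :
  rC1 u -> rC1 w -> rC1 (fun x => u x + w x).
Proof.
move=> [du cu] [dw cw]; split=> [x|nu].
  exact: (@differentiableD _ _ _ u w).
by rewrite rpdD//; exact: econtinuousD.
Qed.

Lemma rC1B (R : realType) (u w : event R -> R) :
  rC1 u -> rC1 w -> rC1 (fun x => u x - w x).
Proof.
move=> [du cu] [dw cw]; split=> [x|nu].
  exact: (@differentiableB _ _ _ u w).
by rewrite rpdB//; exact: econtinuousB.
Qed.

Lemma rC1M (R : realType) (u w : event R -> R) :
  rC1 u -> rC1 w -> rC1 (fun x => u x * w x).
Proof.
move=> [du cu] [dw cw]; split=> [x|nu].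
  exact: (@differentiableM _ _ u w).
rewrite rpdM//; apply: econtinuousD; apply: econtinuousM => //;
  exact: differentiable_econtinuous.
Qed.

Lemma rC1_sum (R : realType) (I : Type) (r : seq I) (u : I -> event R -> R) :
  (forall i, rC1 (u i)) -> rC1 (fun x => \sum_(i <- r) u i x).
Proof.
move=> cu; elim: r => [|i r IHr].
  by under eq_fun do rewrite big_nil; exact: rC1_cst.
by under eq_fun do rewrite big_cons; exact: rC1D.
Qed.

Lemma rC1_comp_mulmx (R : realType) (L : 'M[R]_(1 + 3)) (u : event R -> R) :
  rC1 u -> rC1 (fun x => u (L *m x)).
Proof.
move=> [du cu]; split=> [|nu]; first exact: differentiable_comp_mulmx.
rewrite rpd_comp_mulmx//.
have ci i : continuous (fun x => L i nu * rpd i u (L *m x)).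
  apply: econtinuousM => [|x]; first exact: cst_continuous.
  apply: (@continuous_comp _ _ _ (fun y : event R => L *m y : event R) (rpd i u)).
    exact/differentiable_continuous/differentiable_mulmx.
  exact: cu.
elim: (index_enum _) => [|i r IHr].
  by under eq_fun do rewrite big_nil; exact: cst_continuous.
by under eq_fun do rewrite big_cons; exact: econtinuousD.
Qed.

Lemma rC2I (R : realType) (u : event R -> R) :
  (forall x, differentiable u x) -> (forall mu, rC1 (rpd mu u)) -> rC2 u.
Proof. by move=> du d2; split=> // mu; exact: d2. Qed.

Lemma rC2_cst (R : realType) (k : R) : rC2 (fun=> k).
Proof.
apply: rC2I => [x|mu]; first exact: differentiable_cst.
by rewrite rpd_cst; exact: rC1_cst.
Qed.

Lemma rC2_coord (R : realType) nu : rC2 (fun x : event R => x nu ord0).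
Proof.
apply: rC2I => [x|mu]; first exact: differentiable_coord.
by rewrite rpd_coord; exact: rC1_cst.
Qed.

Lemma rC2D (R : realType) (u w : event R -> R) :
  rC2 u -> rC2 w -> rC2 (fun x => u x + w x).
Proof.
move=> cu cw; have [du _] := cu; have [dw _] := cw.
apply: rC2I => [x|mu]; first exact: (@differentiableD _ _ _ u w).
by rewrite rpdD//; apply: rC1D; exact: rC2_rpd.
Qed.

Lemma rC2B (R : realType) (u w : event R -> R) :
  rC2 u -> rC2 w -> rC2 (fun x => u x - w x).
Proof.
move=> cu cw; have [du _] := cu; have [dw _] := cw.
apply: rC2I => [x|mu]; first exact: (@differentiableB _ _ _ u w).
by rewrite rpdB//; apply: rC1B; exact: rC2_rpd.
Qed.

Lemma rC2M (R : realType) (u w : event R -> R) :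
  rC2 u -> rC2 w -> rC2 (fun x => u x * w x).
Proof.
move=> cu cw; have [du _] := cu; have [dw _] := cw.
apply: rC2I => [x|mu]; first exact: (@differentiableM _ _ u w).
have [[cu1 cw1] [cup cwp]] :=
  (conj (rC2_rC1 cu) (rC2_rC1 cw), conj (rC2_rpd mu cu) (rC2_rpd mu cw)).
by rewrite rpdM//; apply: rC1D; apply: rC1M.
Qed.

Lemma rC2_comp_mulmx (R : realType) (L : 'M[R]_(1 + 3)) (u : event R -> R) :
  rC2 u -> rC2 (fun x => u (L *m x)).
Proof.
move=> cu; have [du _] := cu.
apply: rC2I => [|mu]; first exact: differentiable_comp_mulmx.
rewrite rpd_comp_mulmx//; apply: rC1_sum => nu.
by apply: rC1M; [exact: rC1_cst|apply: rC1_comp_mulmx; exact: rC2_rpd].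
Qed.

Lemma rpdE (R : realType) mu (u : event R -> R) x :
  rpd mu u x = 'D_(delta_mx mu ord0 : event R) u x.
Proof. by []. Qed.

Lemma rpd_shift (R : realType) mu (u : event R -> R) (z : event R) :
  rpd mu (fun y => u (y + z)) = fun y => rpd mu u (y + z).
Proof.
apply/funext => y; rewrite /rpd /derive.
apply: (congr1 (fun F : R -> R^o => lim (F @ 0^')%classic)); apply/funext => k /=.
by rewrite addrA.
Qed.

(* Unification is prone to unfold this, and the constants made opaque below,
   down to filters and limits, and then diverges. *)
Local Opaque rpd.

(** * Composition with functions of one real variable *)

Lemma differentiable_comp1 (R : realType) (g : R -> R) (theta : event R -> R) :
  (forall t, derivable g t (1 : R)) -> (forall x, differentiable theta x) ->
  forall x, differentiable (fun y => g (theta y)) x.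
Proof.
move=> dg dth x; apply: (@differentiable_comp _ _ _ _ theta g) => //.
exact/derivable1_diffP.
Qed.

Lemma rpd_comp1 (R : realType) (g dg : R -> R) (theta : event R -> R) mu :
  (forall t, is_derive t (1 : R) g (dg t)) -> (forall x, differentiable theta x) ->
  rpd mu (fun y => g (theta y)) = fun x => dg (theta x) * rpd mu theta x.
Proof.
move=> Dg dth; apply/funext => x; rewrite !rpdE.
have dgx : differentiable g (theta x) by exact/derivable1_diffP.
rewrite [RHS]mulrC !deriveE//; last first.
  by apply: differentiable_comp1 => // t; apply: ex_derive.
rewrite (@diff_comp _ _ _ _ theta g)//=.
by rewrite diff1E// derive1E derive_val.
Qed.

(** Up to sign, each of the two functions is the derivative of the other, so both are shown to be C1
    first and then both to be C2. *)
Lemma rC2_cos_sin (R : realType) (theta : event R -> R) : rC2 theta ->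
  rC2 (fun x => cos (theta x)) /\ rC2 (fun x => sin (theta x)).
Proof.
move=> cth; have [dth _] := cth.
have dc := differentiable_comp1 (@derivable_cos R) dth.
have ds := differentiable_comp1 (@derivable_sin R) dth.
have rc mu := rpd_comp1 mu (@is_derive_cos R) dth.
have rs mu := rpd_comp1 mu (@is_derive_sin R) dth.
have cth1 := rC2_rC1 cth.
have sinc := differentiable_econtinuous ds.
have nsinc : continuous (fun x => - sin (theta x)).
  have dns t : derivable (fun t => - sin t : R) t (1 : R).
    exact/(@derivableN _ _ _ sin)/derivable_sin.
  exact: (differentiable_econtinuous (differentiable_comp1 dns dth)).
have cosc := differentiable_econtinuous dc.
have cos1 : rC1 (fun x => cos (theta x)).
  by split=> [|mu]; [exact: dc|rewrite rc; exact: (econtinuousM nsinc (cth1.2 mu))].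
have sin1 : rC1 (fun x => sin (theta x)).
  by split=> [|mu]; [exact: ds|rewrite rs; exact: (econtinuousM cosc (cth1.2 mu))].
have nsin1 : rC1 (fun x => - sin (theta x)).
  have := rC1B (rC1_cst 0) sin1.
  by rewrite (_ : (fun _ => _) = (fun x => - sin (theta x)))//; apply/funext => x; rewrite sub0r.
split; apply: rC2I.
- exact: dc.
- by move=> mu; rewrite rc; exact: (rC1M nsin1 (rC2_rpd mu cth)).
- exact: ds.
- by move=> mu; rewrite rs; exact: (rC1M cos1 (rC2_rpd mu cth)).
Qed.

(** * Mean value theorem along lines and symmetry of second derivatives *)

Lemma is_derive_line (R : realType) (u : event R -> R) (x e : event R) (t : R) :
  (forall x, differentiable u x) ->
  is_derive t (1 : R) (fun t => u (x + t *: e)) ('D_e u (x + t *: e)).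
Proof.
move=> du.
have E : (fun h : R => h^-1 *:
    (((fun t => u (x + t *: e)) \o shift t) (h *: (1 : R)) - u (x + t *: e))) =
  (fun h : R => h^-1 *: ((u \o shift (x + t *: e)) (h *: e) - u (x + t *: e))).
  apply/funext => h /=; congr (_ *: (u _ - _)).
  by rewrite [h *: 1]mulr1 scalerDl addrA addrAC addrC addrA.
split; last by rewrite /derive E.
by rewrite /derivable E; exact: diff_derivable.
Qed.

Lemma line_MVT (R : realType) (u : event R -> R) (x e : event R) (h : R) :
  0 <= h -> (forall x, differentiable u x) ->
  exists2 s, 0 <= s <= h & u (x + h *: e) - u x = h * 'D_e u (x + s *: e).
Proof.
move=> h0 du.
have D t := @is_derive_line _ u x e t du.
have [|s] := MVT_segment h0 (fun t _ => D t).
  by apply: derivable_within_continuous => t _; exact: (@ex_derive _ _ _ _ _ _ _ (D t)).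
rewrite in_itv/= => sh; rewrite scale0r addr0 subr0 => E.
by exists s => //; rewrite E mulrC.
Qed.

(** The mean value theorem is applied twice: along [e] to the increment [u (y + h f) - u y], then
    along [f] to the partial derivative of [u] in direction [e]. *)
Lemma second_difference (R : realType) (u : event R -> R) (x : event R)
    mu nu (h : R) : 0 <= h -> rC2 u ->
  let e := delta_mx mu ord0 : event R in
  let f := delta_mx nu ord0 : event R in
  exists s t, [/\ 0 <= s <= h, 0 <= t <= h &
    u (x + h *: e + h *: f) - u (x + h *: e) - (u (x + h *: f) - u x) =
    h ^+ 2 * rpd nu (rpd mu u) (x + s *: e + t *: f)].
Proof.
move=> h0 [du d2] e f.
have dsh : forall y, differentiable (fun y : event R => u (y + h *: f)) y.
  move=> y.
  apply: (@differentiable_comp _ _ _ _ (fun y : event R => y + h *: f) u) => //.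
have dw : forall y, differentiable (fun y : event R => u (y + h *: f) - u y) y.
  move=> y.
  exact: (@differentiableB _ _ _ (fun y => u (y + h *: f)) u).
have [s sh ->] := line_MVT x e h0 dw.
have [t th E] := line_MVT (x + s *: e) f h0 (d2 mu).1.
rewrite -rpdE in E.
exists s, t; split; [exact: sh|exact: th|].
rewrite expr2 -mulrA -E; congr (_ * _).
by rewrite -rpdE (rpdB mu dsh du) rpd_shift.
Qed.

Lemma dist_le_split (R : realType) (p q r eps : R) :
  `|p - r| < eps / 2 -> `|q - r| < eps / 2 -> `|p - q| <= eps.
Proof.
move=> pr qr; have -> : p - q = (p - r) - (q - r) by ring.
by rewrite (le_trans (ler_normB _ _))// [eps]splitr lerD// ltW.
Qed.

(** Schwarz's theorem. The second difference is symmetric in the two directions, so the two mixed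
    derivatives agree at two points arbitrarily close to [x]; continuity carries this to [x]. *)
Lemma rpdC (R : realType) (u : event R -> R) mu nu :
  rC2 u -> rpd mu (rpd nu u) = rpd nu (rpd mu u).
Proof.
move=> cu; apply/funext => x.
apply/eqP; rewrite -subr_eq0 -normr_le0; apply/ler_addgt0Pr => eps eps0.
set e := delta_mx mu ord0 : event R; set f := delta_mx nu ord0 : event R.
have cA : continuous (rpd mu (rpd nu u)) by exact: (cu.2 nu).2.
have cB : continuous (rpd nu (rpd mu u)) by exact: (cu.2 mu).2.
have eps20 : 0 < eps / 2 by rewrite divr_gt0.
have /cvgrPdist_lt /(_ _ eps20) NA := cA x.
have /cvgrPdist_lt /(_ _ eps20) NB := cB x.
have [d /= d0 H] := (nbhs_ballP _ _).1 (filterI NA NB).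
(* With this step every point [x + s e + t f] with [s] and [t] in [[0, h]] lies in the ball of
   radius [d]; the summand 1 makes the bound strict. *)
pose h := d / (`|e| + `|f| + 1).
have K0 : 0 < `|e| + `|f| + 1 by rewrite ltr_wpDl// addr_ge0.
have h0 : 0 < h by rewrite divr_gt0.
have near s t (g k : event R) : `|g| + `|k| = `|e| + `|f| ->
    0 <= s <= h -> 0 <= t <= h -> ball x d (x + s *: g + t *: k).
  move=> gk /andP[s0 sh] /andP[t0 th].
  rewrite -ball_normE /ball_/= -addrA opprD addNKr normrN.
  rewrite (le_lt_trans (ler_normD _ _))// !normrZ !ger0_norm//.
  rewrite (@le_lt_trans _ _ (h * (`|e| + `|f|)))//.
    by rewrite -gk mulrDr lerD// ler_wpM2r.
  rewrite /h mulrAC ltr_pdivrMr// ltr_pM2l// ltrDl//.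
have [s [t [sh th E1]]] := second_difference x mu nu (ltW h0) cu.
have [s' [t' [sh' th' E2]]] := second_difference x nu mu (ltW h0) cu.
rewrite -/e -/f in E1 E2.
have := H _ (near s t e f erefl sh th).
have := H _ (near s' t' f e (addrC _ _) sh' th').
move=> /= [HA _] [_ HB].
(* Regrouping identifies the second difference taken in the order [nu], [mu] with the one taken in
   the order [mu], [nu]. *)
have swap (p q r o : R) : p - q - (r - o) = p - r - (q - o) by ring.
rewrite swap [x + h *: f + _]addrAC in E2.
have h2 : h ^+ 2 != 0 by rewrite expf_neq0// gt_eqF.
have E := mulfI h2 (etrans (esym E2) E1).
rewrite E in HA.
rewrite add0r; exact: (dist_le_split HA HB).
Qed.

(** One use of the mean value theorem on the segment from 0 to [x] suffices. *)
Lemma rpd0_cst (R : realType) (u : event R -> R) :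
  (forall x, differentiable u x) -> (forall mu x, rpd mu u x = 0) ->
  forall x, u x = u 0.
Proof.
move=> du u0 x; apply/eqP; rewrite -subr_eq0.
have [s _] := @line_MVT _ u 0 x 1 ler01 du.
rewrite add0r scale1r => ->; rewrite derive_sum_rpd//.
by rewrite big1 ?mulr0// => nu _; rewrite u0 mulr0.
Qed.

Local Opaque cos sin.

(** * Complex functions of an event *)

Lemma complexReM (R : realType) (z w : R[i]) : complex.Re (z * w) =
  complex.Re z * complex.Re w - complex.Im z * complex.Im w.
Proof. by case: z w => [a b] [c d]. Qed.

Lemma complexImM (R : realType) (z w : R[i]) : complex.Im (z * w) =
  complex.Re z * complex.Im w + complex.Im z * complex.Re w.
Proof. by case: z w => [a b] [c d]. Qed.

Lemma complexReD (R : realType) (z w : R[i]) :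
  complex.Re (z + w) = complex.Re z + complex.Re w.
Proof. by case: z w => [a b] [c d]. Qed.

Lemma complexImD (R : realType) (z w : R[i]) :
  complex.Im (z + w) = complex.Im z + complex.Im w.
Proof. by case: z w => [a b] [c d]. Qed.

Definition cdiff (R : realType) (Psi : event R -> R[i]) : Prop :=
  (forall x, differentiable (fun y => complex.Re (Psi y)) x) /\
  (forall x, differentiable (fun y => complex.Im (Psi y)) x).

Lemma C2_cdiff (R : realType) (Psi : event R -> R[i]) : C2 Psi -> cdiff Psi.
Proof. by move=> [[? _] [? _]]. Qed.

Lemma C2_pd_cdiff (R : realType) (Psi : event R -> R[i]) mu :
  C2 Psi -> cdiff (pd mu Psi).
Proof. by move=> [[_ dr] [_ di]]; split=> x; [apply: (dr mu).1|apply: (di mu).1]. Qed.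

Lemma pd0_cst (R : realType) (h : event R -> R[i]) : cdiff h ->
  (forall mu x, pd mu h x = 0) -> forall x, h x = h 0.
Proof.
move=> [dr di] h0 x.
have re0 mu y : rpd mu (fun z => complex.Re (h z)) y = 0.
  by have := congr1 (@complex.Re R) (h0 mu y).
have im0 mu y : rpd mu (fun z => complex.Im (h z)) y = 0.
  by have := congr1 (@complex.Im R) (h0 mu y).
have := f_equal2 (fun s t => s +i* t) (rpd0_cst dr re0 x) (rpd0_cst di im0 x).
by case: (h x) (h 0) => [? ?] [].
Qed.

Lemma cdiff_cst (R : realType) (k : R[i]) : cdiff (fun _ : event R => k).
Proof. by split=> x; exact: differentiable_cst. Qed.

Lemma cdiffD (R : realType) (Phi Psi : event R -> R[i]) :
  cdiff Phi -> cdiff Psi -> cdiff (fun x => Phi x + Psi x).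
Proof.
move=> [dr di] [er ei]; split=> x.
  under eq_fun do rewrite complexReD.
  exact: (@differentiableD _ _ _ (fun y => complex.Re (Phi y))
                                 (fun y => complex.Re (Psi y))).
under eq_fun do rewrite complexImD.
exact: (@differentiableD _ _ _ (fun y => complex.Im (Phi y))
                               (fun y => complex.Im (Psi y))).
Qed.

Lemma cdiffM (R : realType) (Phi Psi : event R -> R[i]) :
  cdiff Phi -> cdiff Psi -> cdiff (fun x => Phi x * Psi x).
Proof.
move=> [dr di] [er ei]; split=> x.
  under eq_fun do rewrite complexReM.
  apply: (@differentiableB _ _ _
    (fun y => complex.Re (Phi y) * complex.Re (Psi y))
    (fun y => complex.Im (Phi y) * complex.Im (Psi y))).
    exact: (@differentiableM _ _ (fun y => complex.Re (Phi y))
                                 (fun y => complex.Re (Psi y))).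
  exact: (@differentiableM _ _ (fun y => complex.Im (Phi y))
                               (fun y => complex.Im (Psi y))).
under eq_fun do rewrite complexImM.
apply: (@differentiableD _ _ _
  (fun y => complex.Re (Phi y) * complex.Im (Psi y))
  (fun y => complex.Im (Phi y) * complex.Re (Psi y))).
  exact: (@differentiableM _ _ (fun y => complex.Re (Phi y))
                               (fun y => complex.Im (Psi y))).
exact: (@differentiableM _ _ (fun y => complex.Im (Phi y))
                             (fun y => complex.Re (Psi y))).
Qed.

Lemma pd_cst (R : realType) mu (k : R[i]) :
  pd mu (fun _ : event R => k) = fun=> 0.
Proof. by apply/funext => x; rewrite /pd !rpd_cst. Qed.

Lemma pdD (R : realType) mu (Phi Psi : event R -> R[i]) :
  cdiff Phi -> cdiff Psi ->
  pd mu (fun x => Phi x + Psi x) = fun x => pd mu Phi x + pd mu Psi x.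
Proof.
move=> [dr di] [er ei]; apply/funext => x; rewrite /pd.
under [X in rpd _ X _ +i* _]eq_fun do rewrite complexReD.
under [X in _ +i* rpd _ X _]eq_fun do rewrite complexImD.
by rewrite !rpdD.
Qed.

Lemma pdM (R : realType) mu (Phi Psi : event R -> R[i]) :
  cdiff Phi -> cdiff Psi ->
  pd mu (fun x => Phi x * Psi x) =
  fun x => pd mu Phi x * Psi x + Phi x * pd mu Psi x.
Proof.
move=> [dr di] [er ei]; apply/funext => x; rewrite /pd.
under [X in rpd _ X _ +i* _]eq_fun do rewrite complexReM.
under [X in _ +i* rpd _ X _]eq_fun do rewrite complexImM.
have dM (u w : event R -> R) : (forall x, differentiable u x) ->
    (forall x, differentiable w x) -> forall x, differentiable (fun x => u x * w x) x.
  by move=> du dw y; exact: (@differentiableM _ _ u w).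
rewrite rpdB ?rpdD; do ?exact: dM.
rewrite !rpdM//.
by apply/eqP; rewrite eq_complex/= complexReD complexImD !complexReM !complexImM/=; apply/andP; split;
  apply/eqP; ring.
Qed.

Lemma pdZ (R : realType) mu (k : R[i]) (Psi : event R -> R[i]) : cdiff Psi ->
  pd mu (fun x => k * Psi x) = fun x => k * pd mu Psi x.
Proof.
move=> dPsi; rewrite (pdM mu (cdiff_cst k) dPsi) pd_cst.
by apply/funext => x; rewrite mul0r add0r.
Qed.

Lemma cdiff_pd_sumZ (R : realType) (I : Type) (r : seq I) mu (k : I -> R[i])
    (Psi : I -> event R -> R[i]) : (forall i, cdiff (Psi i)) ->
  cdiff (fun x => \sum_(i <- r) k i * Psi i x) /\
  pd mu (fun x => \sum_(i <- r) k i * Psi i x) =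
  fun x => \sum_(i <- r) k i * pd mu (Psi i) x.
Proof.
move=> dPsi; elim: r => [|i r [dr IHr]].
  under eq_fun do rewrite big_nil.
  split; first exact: cdiff_cst.
  by rewrite pd_cst; apply/funext => x; rewrite big_nil.
under eq_fun do rewrite big_cons.
have dki : cdiff (fun x => k i * Psi i x) by apply: cdiffM => //; exact: cdiff_cst.
split; first exact: cdiffD.
by rewrite pdD// IHr pdZ//; apply/funext => x; rewrite big_cons.
Qed.

Lemma C2_cst (R : realType) (k : R[i]) : C2 (fun _ : event R => k).
Proof. by split; exact: rC2_cst. Qed.

Lemma C2_coord (R : realType) nu : C2 (fun x : event R => (x nu ord0)%:C).
Proof. by split; [exact: rC2_coord|exact: rC2_cst]. Qed.

Lemma C2M (R : realType) (Phi Psi : event R -> R[i]) :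
  C2 Phi -> C2 Psi -> C2 (fun x => Phi x * Psi x).
Proof.
move=> [cr ci] [er ei]; split.
  under eq_fun do rewrite complexReM.
  by apply: rC2B; exact: rC2M.
under eq_fun do rewrite complexImM.
by apply: rC2D; exact: rC2M.
Qed.

Lemma C2_comp_mulmx (R : realType) (L : 'M[R]_(1 + 3)) (Psi : event R -> R[i]) :
  C2 Psi -> C2 (fun x => Psi (L *m x)).
Proof.
move=> [cr ci]; split.
  exact: (@rC2_comp_mulmx _ L (fun y => complex.Re (Psi y))).
exact: (@rC2_comp_mulmx _ L (fun y => complex.Im (Psi y))).
Qed.

Lemma pd_coord (R : realType) mu nu :
  pd mu (fun x : event R => (x nu ord0)%:C) = fun=> (nu == mu)%:R.
Proof.
apply/funext => x; rewrite /pd rpd_coord rpd_cst.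
by case: (nu == mu).
Qed.

Lemma pdC (R : realType) mu nu (Psi : event R -> R[i]) : C2 Psi ->
  pd mu (pd nu Psi) = pd nu (pd mu Psi).
Proof.
move=> [cr ci]; apply/funext => x.
exact: (f_equal2 (fun s t => s +i* t) (congr1 (@^~ x) (rpdC mu nu cr))
                                      (congr1 (@^~ x) (rpdC mu nu ci))).
Qed.

Lemma pd_comp_mulmx (R : realType) (L : 'M[R]_(1 + 3)) (Psi : event R -> R[i]) mu :
  cdiff Psi -> pd mu (fun x => Psi (L *m x)) =
  fun x => \sum_nu (L nu mu)%:C * pd nu Psi (L *m x).
Proof.
move=> [dr di]; apply/funext => x; rewrite /pd.
rewrite (@rpd_comp_mulmx _ L (fun y => complex.Re (Psi y)))//.
rewrite (@rpd_comp_mulmx _ L (fun y => complex.Im (Psi y)))//.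
elim: (index_enum _) => [|nu r IHr]; first by rewrite !big_nil.
rewrite !big_cons -IHr.
by apply/eqP; rewrite eq_complex complexReD complexImD complexReM complexImM/= !mul0r subr0 addr0 !eqxx.
Qed.

Lemma cdiff_comp_mulmx (R : realType) (L : 'M[R]_(1 + 3))
    (Psi : event R -> R[i]) : cdiff Psi -> cdiff (fun x => Psi (L *m x)).
Proof.
move=> [dr di]; split.
  exact: (@differentiable_comp_mulmx _ L (fun y => complex.Re (Psi y))).
exact: (@differentiable_comp_mulmx _ L (fun y => complex.Im (Psi y))).
Qed.

Lemma pd2_comp_mulmx (R : realType) (L : 'M[R]_(1 + 3)) (Psi : event R -> R[i])
    mu nu : C2 Psi -> pd mu (pd nu (fun x => Psi (L *m x))) =
  fun x => \sum_al \sum_be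
    (L al nu)%:C * (L be mu)%:C * pd be (pd al Psi) (L *m x).
Proof.
move=> cPsi; rewrite pd_comp_mulmx; last exact: C2_cdiff.
have dP al := C2_pd_cdiff al cPsi.
have [_ ->] := @cdiff_pd_sumZ _ _ (index_enum _) mu (fun al => (L al nu)%:C) _
  (fun al => cdiff_comp_mulmx L (dP al)).
apply/funext => x; apply: eq_bigr => al _.
rewrite pd_comp_mulmx// big_distrr/=; apply: eq_bigr => be _.
by rewrite mulrA.
Qed.

Lemma pd2M (R : realType) mu nu (Phi Psi : event R -> R[i]) :
  C2 Phi -> C2 Psi -> pd mu (pd nu (fun x => Phi x * Psi x)) =
  fun x => pd mu (pd nu Phi) x * Psi x + pd nu Phi x * pd mu Psi x +
    (pd mu Phi x * pd nu Psi x + Phi x * pd mu (pd nu Psi) x).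
Proof.
move=> cPhi cPsi.
have [dPhi dPsi] := (C2_cdiff cPhi, C2_cdiff cPsi).
have [dPhi' dPsi'] := (C2_pd_cdiff nu cPhi, C2_pd_cdiff nu cPsi).
by rewrite (pdM nu)// pdD; do ?exact: cdiffM; rewrite !pdM.
Qed.

Lemma C2_expi (R : realType) (theta : event R -> R) :
  rC2 theta -> C2 (fun x => expi (theta x)).
Proof. by move=> /rC2_cos_sin cs; rewrite /C2 /expi /=; exact: cs. Qed.

Lemma pd_expi (R : realType) mu (theta : event R -> R) :
  (forall x, differentiable theta x) -> pd mu (fun x => expi (theta x)) =
  fun x => iC * (rpd mu theta x)%:C * expi (theta x).
Proof.
move=> dth; apply/funext => x; rewrite /pd/=.
rewrite (rpd_comp1 mu (@is_derive_cos R) dth) (rpd_comp1 mu (@is_derive_sin R) dth).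
apply/eqP; rewrite eq_complex !complexReM !complexImM/=; apply/andP; split; apply/eqP; ring.
Qed.

Lemma expi_neq0 (R : realType) (t : R) : expi t != 0.
Proof.
rewrite eq_complex/=; apply/negP => /andP[/eqP c0 /eqP s0].
by have := cos2Dsin2 t; rewrite c0 s0 !expr0n/= addr0 => /esym/eqP; rewrite oner_eq0.
Qed.

(** * Plane waves *)

Lemma big_event (V : nmodType) (F : 'I_(1 + 3) -> V) :
  \sum_mu F mu = F ord0 + \sum_(i < 3) F (rshift 1 i).
Proof.
rewrite big_split_ord/= big_ord1; congr (F _ + _); exact: val_inj.
Qed.

(** The gradient of the phase [k . r - omega t] in the coordinates [x^mu]; the time component is
    [- omega / c] because [t = x^0 / c]. *)
Definition wave_covector (R : realType) (c : R) (k : 'cV[R]_3) (omega : R)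
    (mu : 'I_(1 + 3)) : R :=
  col_mx (- (omega / c))%:M k mu ord0.

Lemma wave_covector0 (R : realType) (c : R) (k : 'cV[R]_3) (omega : R) :
  wave_covector c k omega ord0 = - (omega / c).
Proof.
by rewrite /wave_covector mxE; case: splitP => // j _; rewrite ord1 mxE.
Qed.

Lemma wave_covectorS (R : realType) (c : R) (k : 'cV[R]_3) (omega : R) i :
  wave_covector c k omega (rshift 1 i) = k i ord0.
Proof. by rewrite /wave_covector col_mxEd. Qed.

Lemma plane_wave_phase (R : realType) (c : R) (k : 'cV[R]_3) (omega : R) :
  (fun x => dot k (epos x) - omega * etime c x) =
  (fun x => \sum_mu wave_covector c k omega mu * x mu ord0).
Proof.
apply/funext => x; rewrite big_event// wave_covector0 addrC; congr (_ + _).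
  by apply: eq_bigr => i _; rewrite wave_covectorS mxE.
by rewrite /etime mulNr mulrAC mulrA.
Qed.

Lemma rC2_linear_form (R : realType) (p : 'I_(1 + 3) -> R) :
  rC2 (fun x : event R => \sum_mu p mu * x mu ord0) /\
  forall nu, rpd nu (fun x : event R => \sum_mu p mu * x mu ord0) = fun=> p nu.
Proof.
(* The derivative is first left as a sum of Kronecker symbols, a form that admits induction on the
   list of indices. *)
suff [c2 dp] : rC2 (fun x : event R => \sum_mu p mu * x mu ord0) /\
  forall nu, rpd nu (fun x : event R => \sum_mu p mu * x mu ord0) =
     fun=> \sum_mu p mu * (mu == nu)%:R.
  split=> // nu; rewrite dp; apply/funext => x.
  rewrite (bigD1 nu)//= eqxx mulr1 big1 ?addr0// => mu /negbTE ->.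
  by rewrite mulr0.
elim: (index_enum _) => [|mu r [IH1 IH2]].
  under eq_fun do rewrite big_nil.
  split=> [|nu]; first exact: rC2_cst.
  by rewrite rpd_cst; apply/funext => x; rewrite big_nil.
under eq_fun do rewrite big_cons.
have cmu : rC2 (fun x : event R => p mu * x mu ord0).
  by apply: rC2M; [exact: rC2_cst|exact: rC2_coord].
split=> [|nu]; first exact: (rC2D cmu IH1).
rewrite (rpdD nu cmu.1 IH1.1) IH2 (rpdM nu (rC2_cst (p mu)).1 (rC2_coord R mu).1).
by apply/funext => x; rewrite big_cons rpd_coord rpd_cst mul0r addr0.
Qed.

Lemma C2_plane_wave (R : realType) (c : R) (Psi0 : R[i]) (k : 'cV[R]_3) (omega : R) :
  C2 (plane_wave c Psi0 k omega).
Proof.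
apply: C2M; first exact: C2_cst.
apply: C2_expi; rewrite plane_wave_phase; exact: (rC2_linear_form _).1.
Qed.

Lemma pd_plane_wave (R : realType) mu (c : R) (Psi0 : R[i]) (k : 'cV[R]_3) (omega : R) :
  pd mu (plane_wave c Psi0 k omega) =
  fun x => iC * (wave_covector c k omega mu)%:C * plane_wave c Psi0 k omega x.
Proof.
have [c2 dp] := rC2_linear_form (wave_covector c k omega).
rewrite -plane_wave_phase in c2 dp.
rewrite pdZ; last exact/C2_cdiff/C2_expi.
rewrite pd_expi ?dp; last exact: c2.1.
by apply/funext => x; rewrite /plane_wave mulrCA.
Qed.

Lemma pd2_plane_wave (R : realType) mu nu (c : R) (Psi0 : R[i]) (k : 'cV[R]_3) (omega : R) :
  pd mu (pd nu (plane_wave c Psi0 k omega)) =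
  fun x => - (wave_covector c k omega mu * wave_covector c k omega nu)%:C *
    plane_wave c Psi0 k omega x.
Proof.
rewrite pd_plane_wave pdZ; last exact/C2_cdiff/C2_plane_wave.
rewrite pd_plane_wave; apply/funext => x.
have i2 : iC * iC = -1 :> R[i] by rewrite -expr2 sqr_i.
rewrite rmorphM/=; transitivity (iC * iC * (wave_covector c k omega mu)%:C *
   (wave_covector c k omega nu)%:C * plane_wave c Psi0 k omega x); first by ring.
by rewrite i2; ring.
Qed.

Lemma plane_wave_neq0 (R : realType) (c : R) (Psi0 : R[i]) (k : 'cV[R]_3) (omega : R) x :
  Psi0 != 0 -> plane_wave c Psi0 k omega x != 0.
Proof. by move=> P0; rewrite mulf_neq0// expi_neq0. Qed.

Local Opaque pd.

(** * From plane waves to the Schroedinger equation *)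

Lemma iCM (R : realType) : iC * iC = -1 :> R[i].
Proof. by rewrite -expr2 sqr_i. Qed.

Lemma iC_neq0 (R : realType) : iC != 0 :> R[i].
Proof. by rewrite eq_complex/= oner_eq0 andbF. Qed.

(** * Coefficients forced by the dispersion relation *)

(** The five arguments 1, -1, 2, -2 and 3 determine a quartic. The argument 0 is excluded because
    [k = s u] has to be nonzero. *)
Lemma quartic_coef0 (F : numFieldType) (c0 c1 c2 c3 c4 : F) :
  (forall n : int, n != 0 -> c4 * n%:~R ^+ 4 + c3 * n%:~R ^+ 3 +
    c2 * n%:~R ^+ 2 + c1 * n%:~R + c0 = 0) ->
  [/\ c4 = 0, c3 = 0, c2 = 0, c1 = 0 & c0 = 0].
Proof.
pose p s := c4 * s ^+ 4 + c3 * s ^+ 3 + c2 * s ^+ 2 + c1 * s + c0 => H.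
have p1 : p 1 = 0 := H 1 isT.
have pN1 : p (- 1) = 0 := H (- 1) isT.
have p2 : p 2 = 0 := H 2 isT.
have pN2 : p (- 2) = 0 := H (- 2) isT.
have p3 : p 3 = 0 := H 3 isT.
(* [div0 n] cancels the factor [n + 1]: the combinations of values below isolate [12 c3], [2 c1],
   [120 c4] and [3 c2]. *)
have div0 (n : nat) (z : F) : n.+1%:R * z = 0 -> z = 0.
  by move=> /eqP; rewrite mulf_eq0 pnatr_eq0 => /eqP.
have z3 : c3 = 0.
  apply: (div0 11); transitivity (p 2 - p (- 2) - 2 * (p 1 - p (- 1))).
    by rewrite /p; ring.
  by rewrite p1 p2 pN1 pN2; ring.
have z1 : c1 = 0.
  apply: (div0 1); transitivity (p 1 - p (- 1) - 2 * c3); first by rewrite /p; ring.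
  by rewrite p1 pN1 z3; ring.
have z4 : c4 = 0.
  apply: (div0 119).
  transitivity (3 * (p 3 - p 1 - 26%:R * c3 - 2 * c1)
                - 8%:R * (p 2 - p 1 - 7%:R * c3 - c1)); first by rewrite /p; ring.
  by rewrite p1 p2 p3 z1 z3; ring.
have z2 : c2 = 0.
  apply: (div0 2); transitivity (p 2 - p 1 - 15%:R * c4 - 7%:R * c3 - c1).
    by rewrite /p; ring.
  by rewrite p1 p2 z1 z3 z4; ring.
by split=> //; rewrite -p1 /p z1 z2 z3 z4; ring.
Qed.

(** Each derivative multiplies a plane wave by [i p_mu], so the operator acts as multiplication by
    its symbol. *)
Lemma waveop_plane_wave (R : realType) (c : R) (a : 'M[R[i]]_(1 + 3))
    (b : 'cV[R[i]]_(1 + 3)) (f : event R -> R[i]) (Psi0 : R[i]) (k : 'cV[R]_3)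
    (omega : R) (x : event R) :
  let p mu := (wave_covector c k omega mu)%:C in
  waveop a b f (plane_wave c Psi0 k omega) x =
  (f x - \sum_mu \sum_nu a mu nu * (p mu * p nu) +
   iC * \sum_mu b mu ord0 * p mu) * plane_wave c Psi0 k omega x.
Proof.
move=> p; rewrite /waveop mulrDl mulrBl addrC -[RHS]addrA; congr (_ + _).
rewrite -mulNr -sumrN mulr_suml; congr (_ + _).
  apply: eq_bigr => mu _; rewrite -sumrN mulr_suml; apply: eq_bigr => nu _.
  by rewrite pd2_plane_wave rmorphM/=; ring.
rewrite -mulrA mulr_suml mulr_sumr; apply: eq_bigr => mu _.
by rewrite pd_plane_wave; ring.
Qed.

Lemma quadratic_event (R : realType) (a : 'M[R[i]]_(1 + 3))
    (p : 'I_(1 + 3) -> R[i]) :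
  \sum_mu \sum_nu a mu nu * (p mu * p nu) =
  a ord0 ord0 * p ord0 ^+ 2 +
  p ord0 * (\sum_(i < 3)
    (a ord0 (rshift 1 i) + a (rshift 1 i) ord0) * p (rshift 1 i)) +
  \sum_(i < 3) \sum_(j < 3)
    a (rshift 1 i) (rshift 1 j) * (p (rshift 1 i) * p (rshift 1 j)).
Proof.
rewrite big_event big_event.
under [X in _ + X = _]eq_bigr do rewrite big_event.
rewrite big_split/= !addrA; congr (_ + _).
rewrite -expr2 -addrA; congr (_ + _).
rewrite mulr_sumr -big_split/=; apply: eq_bigr => i _; ring.
Qed.

Lemma dotZ (R : realType) (s : R) (u : 'cV[R]_3) :
  dot (s *: u) (s *: u) = s ^+ 2 * dot u u.
Proof.
rewrite /dot mulr_sumr; apply: eq_bigr => i _; rewrite !mxE; ring.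
Qed.

Lemma sum_basis (R : realType) (z : 'I_3 -> R[i]) i :
  \sum_j z j * ((delta_mx i ord0 : 'cV[R]_3) j ord0)%:C = z i.
Proof.
rewrite (bigD1 i)//= mxE !eqxx mulr1 big1 ?addr0// => j /negbTE ji.
by rewrite mxE ji mulr0.
Qed.

Lemma dot_basis (R : realType) (u : 'cV[R]_3) i :
  dot u (delta_mx i ord0) = u i ord0.
Proof.
rewrite /dot (bigD1 i)//= mxE !eqxx mulr1 big1 ?addr0// => j /negbTE ji.
by rewrite mxE ji mulr0.
Qed.

(** [F V0] stands for the value of [f] at one fixed event in the constant potential [V0]. For
    [V0 = 0] the time component of the covector is quadratic in [k], so the powers of the scale of
    [k] separate the blocks of [a] and [b]. Only the symmetric part of [a] is determined. *)
Lemma dispersion_coefs (R : realType) (c hbar m : R)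
    (a : 'M[R[i]]_(1 + 3)) (b : 'cV[R[i]]_(1 + 3)) (F : R -> R[i]) :
  0 < c -> 0 < hbar -> 0 < m ->
  (forall V0 (k : 'cV[R]_3), k != 0 ->
    let p mu :=
      (wave_covector c k (hbar * dot k k / (2 * m) + V0 / hbar) mu)%:C in
    F V0 - \sum_mu \sum_nu a mu nu * (p mu * p nu) +
      iC * \sum_mu b mu ord0 * p mu = 0) ->
  let b0 := b ord0 ord0 in
  [/\ a ord0 ord0 = 0,
      forall i, a ord0 (rshift 1 i) + a (rshift 1 i) ord0 = 0,
      forall i, b (rshift 1 i) ord0 = 0,
      forall i j, a (rshift 1 i) (rshift 1 j) + a (rshift 1 j) (rshift 1 i) =
        - 2 * iC * b0 * (hbar / (2 * m * c))%:C * (i == j)%:R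
    & forall V0, F V0 = iC * b0 * (V0 / (hbar * c))%:C].
Proof.
move=> c0 hbar0 m0 H b0.
(* For zero potential the time component of the covector is [- ga |k|^2]. *)
set ga := hbar / (2 * m * c).
have cN0 : c != 0 by rewrite gt_eqF.
have hN0 : hbar != 0 by rewrite gt_eqF.
have mN0 : m != 0 by rewrite gt_eqF.
have ga0 : ga != 0 by rewrite gt_eqF// divr_gt0// !mulr_gt0.
(* The quadratic form of the spatial block, nested so that [sum_basis] evaluates each of the two
   sums. *)
pose A (u : 'cV[R]_3) : R[i] := \sum_(i < 3) (\sum_(j < 3)
  a (rshift 1 i) (rshift 1 j) * (u j ord0)%:C) * (u i ord0)%:C.
have Hexp V0 (k : 'cV[R]_3) : k != 0 ->
    let q := (- ((hbar * dot k k / (2 * m) + V0 / hbar) / c))%:C in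
    F V0 - (a ord0 ord0 * q ^+ 2 + q * (\sum_(i < 3)
      (a ord0 (rshift 1 i) + a (rshift 1 i) ord0) * (k i ord0)%:C) + A k)
    + iC * (b0 * q + \sum_(i < 3) b (rshift 1 i) ord0 * (k i ord0)%:C) = 0.
  move=> k0 q; rewrite -[RHS](H V0 k k0) /=.
  rewrite quadratic_event [in RHS](big_event (fun mu => b mu ord0 * _)).
  rewrite wave_covector0; congr (_ - (_ + _ * _ + _) + _ * (_ + _)).
  - by apply: eq_bigr => i _; rewrite wave_covectorS.
  - apply: eq_bigr => i _; rewrite mulr_suml; apply: eq_bigr => j _.
    by rewrite !wave_covectorS; ring.
  - by apply: eq_bigr => i _; rewrite wave_covectorS.
(* These are the coefficients of degrees 4, 3, 2, 1, 0 in [n] of the identity for [V0 = 0] and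
   [k = n u]. *)
have poly (u : 'cV[R]_3) : u != 0 ->
    [/\ - (a ord0 ord0 * (ga * dot u u)%:C ^+ 2) = 0,
      (ga * dot u u)%:C * (\sum_(i < 3)
        (a ord0 (rshift 1 i) + a (rshift 1 i) ord0) * (u i ord0)%:C) = 0,
      - A u - iC * b0 * (ga * dot u u)%:C = 0,
      iC * (\sum_(i < 3) b (rshift 1 i) ord0 * (u i ord0)%:C) = 0 & F 0 = 0].
  move=> u0; apply: quartic_coef0 => n n0.
  have nu0 : n%:~R *: u != 0 by rewrite scaler_eq0 negb_or u0 intr_eq0 n0.
  have nC : (n%:~R : R)%:C = n%:~R by rewrite rmorph_int.
  rewrite -[RHS](Hexp 0 _ nu0)/= dotZ mul0r addr0.
  have -> : - (hbar * (n%:~R ^+ 2 * dot u u) / (2 * m) / c) =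
    - n%:~R ^+ 2 * (ga * dot u u) by rewrite /ga; field; rewrite cN0 mN0.
  have sumZ (z : 'I_3 -> R[i]) :
      \sum_(i < 3) z i * ((n%:~R *: u) i ord0)%:C =
      n%:~R * \sum_(i < 3) z i * (u i ord0)%:C.
    by rewrite mulr_sumr; apply: eq_bigr => i _; rewrite mxE rmorphM/= nC; ring.
  have -> : A (n%:~R *: u) = n%:~R ^+ 2 * A u.
    rewrite /A; under eq_bigr do rewrite sumZ.
    rewrite (sumZ (fun i => n%:~R * _)) mulr_sumr [RHS]mulr_sumr.
    by apply: eq_bigr => i _; ring.
  have -> : (- n%:~R ^+ 2 * (ga * dot u u))%:C = - n%:~R ^+ 2 * (ga * dot u u)%:C.
    by rewrite rmorphM rmorphN rmorphXn/= nC.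
  rewrite !sumZ; ring.
have e_neq0 i : delta_mx i ord0 != 0 :> 'cV[R]_3.
  apply/eqP => /matrixP/(_ i ord0); rewrite !mxE !eqxx => /eqP.
  by rewrite oner_eq0.
have dote i : dot (delta_mx i ord0) (delta_mx i ord0) = 1 :> R.
  by rewrite dot_basis mxE !eqxx.
have gaC : ga%:C != 0 by rewrite eq_complex/= eqxx andbT.
have a00 : a ord0 ord0 = 0.
  have [/eqP + _ _ _ _] := poly _ (e_neq0 ord0).
  by rewrite dote mulr1 oppr_eq0 mulf_eq0 sqrf_eq0 (negbTE gaC) orbF => /eqP.
have a0i i : a ord0 (rshift 1 i) + a (rshift 1 i) ord0 = 0.
  have [_ /eqP + _ _ _] := poly _ (e_neq0 i).
  by rewrite dote mulr1 sum_basis mulf_eq0 (negbTE gaC)/= => /eqP.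
have bi i : b (rshift 1 i) ord0 = 0.
  have [_ _ _ /eqP + _] := poly _ (e_neq0 i).
  by rewrite sum_basis mulf_eq0 (negbTE (iC_neq0 R))/= => /eqP.
have aii i : a (rshift 1 i) (rshift 1 i) = - (iC * b0 * ga%:C).
  have [_ _ /eqP + _ _] := poly _ (e_neq0 i).
  rewrite dote mulr1 /A sum_basis sum_basis subr_eq0 => /eqP <-.
  by rewrite opprK.
split=> //.
- move=> i j; have [<-|ij] := eqVneq i j; first by rewrite aii mulr1; ring.
  (* Polarization: on the sum of two basis vectors the quadratic form contains the mixed entries,
     and the diagonal ones are already known. *)
  pose u : 'cV[R]_3 := delta_mx i ord0 + delta_mx j ord0.
  have sum2 (z : 'I_3 -> R[i]) : \sum_l z l * (u l ord0)%:C = z i + z j.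
    rewrite -(sum_basis z i) -(sum_basis z j) -big_split/=.
    by apply: eq_bigr => l _; rewrite mxE rmorphD/= mulrDr.
  have ui : u i ord0 = 1 by rewrite !mxE !eqxx (negbTE ij) addr0.
  have uj : u j ord0 = 1 by rewrite !mxE !eqxx eq_sym (negbTE ij) add0r.
  have u0 : u != 0.
    by apply/eqP => /matrixP/(_ i ord0); rewrite ui mxE => /eqP; rewrite oner_eq0.
  have dotu : dot u u = 2.
    transitivity (dot u (delta_mx i ord0) + dot u (delta_mx j ord0)).
      by rewrite /dot -big_split/=; apply: eq_bigr => l _; rewrite -mulrDr mxE.
    by rewrite !dot_basis ui uj.
  have [_ _ /eqP + _ _] := poly _ u0.
  rewrite dotu /A sum2 !sum2 !aii subr_eq0 => /eqP E.
  have ga2 : (ga * 2)%:C = ga%:C * 2 by rewrite mulr_natr rmorphMn -mulr_natr.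
  rewrite ga2 in E.
  rewrite mulr0; set z := _ + _.
  rewrite -[z](addrK (- (iC * b0 * ga%:C) - (iC * b0 * ga%:C))).
  transitivity (- (iC * b0 * (ga%:C * 2)) + 2 * (iC * b0 * ga%:C)); last by ring.
  by rewrite -E /z; ring.
(* With the coefficients known, the identity for general [V0] at a single unit vector can be solved
   for [F V0]. *)
- move=> V0; have /= E := Hexp V0 _ (e_neq0 ord0).
  move: E; rewrite a00 !sum_basis a0i bi mulr0 mul0r /A !sum_basis aii dote mulr1.
  set q := - (_ / c) => E.
  have -> : V0 / (hbar * c) = - q - ga.
    by rewrite /q /ga; field; rewrite cN0 hN0 mN0.
  move: E; clearbody q => E.
  rewrite -[LHS]subr0 -E rmorphB rmorphN/=; ring.
Qed.

(** * Recovery of the wave operator from its coefficients *)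

Lemma sum_symmetric (R : realType) (n : nat) (a h : 'I_n -> 'I_n -> R[i]) :
  (forall i j, h i j = h j i) ->
  2 * \sum_i \sum_j a i j * h i j = \sum_i \sum_j (a i j + a j i) * h i j.
Proof.
move=> hC; rewrite mulr_natl mulr2n {2}exchange_big/= -big_split/=.
apply: eq_bigr => i _; rewrite -big_split/=; apply: eq_bigr => j _.
by rewrite mulrDl [h j i]hC.
Qed.

(** A symmetric [h] sees only the symmetric part of [a]. It will be the matrix of second
    derivatives, which is symmetric on C2 functions. *)
Lemma contraction_of_coefs (R : realType) (s : R[i]) (a : 'M[R[i]]_(1 + 3))
    (h : 'I_(1 + 3) -> 'I_(1 + 3) -> R[i]) :
  (forall i j, h i j = h j i) ->
  a ord0 ord0 = 0 ->
  (forall i, a ord0 (rshift 1 i) + a (rshift 1 i) ord0 = 0) ->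
  (forall i j, a (rshift 1 i) (rshift 1 j) + a (rshift 1 j) (rshift 1 i) =
        2 * s * (i == j)%:R) ->
  \sum_mu \sum_nu a mu nu * h mu nu =
  s * \sum_(i < 3) h (rshift 1 i) (rshift 1 i).
Proof.
move=> hC a00 a0i aij.
have n2 : 2 != 0 :> R[i] by rewrite pnatr_eq0.
apply: (mulfI n2); rewrite (sum_symmetric a hC) big_event.
rewrite [X in X + _]big_event a00 addr0 mul0r add0r.
rewrite [X in X + _]big1 ?add0r; last by move=> i _; rewrite a0i mul0r.
rewrite !mulr_sumr; apply: eq_bigr => i _.
rewrite big_event addrC [a _ ord0 + _]addrC a0i mul0r addr0 (bigD1 i)//=.
rewrite aij eqxx mulr1 big1 ?addr0 ?mulrA// => j ji.
by rewrite aij eq_sym (negbTE ji) mulr0 mul0r.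
Qed.

(** Comparing [b^0] with the coefficient [i hbar c] of the derivative along [x^0] in the
    Schroedinger equation gives the overall factor [- i b^0 / (hbar c)]. *)
Lemma waveop_of_coefs (R : realType) (c hbar m : R)
    (a : 'M[R[i]]_(1 + 3)) (b : 'cV[R[i]]_(1 + 3)) (f : event R -> R[i])
    (V : event R -> R) (Psi : event R -> R[i]) (x : event R) :
  0 < c -> 0 < hbar -> 0 < m -> C2 Psi ->
  let b0 := b ord0 ord0 in
  a ord0 ord0 = 0 ->
  (forall i, a ord0 (rshift 1 i) + a (rshift 1 i) ord0 = 0) ->
  (forall i, b (rshift 1 i) ord0 = 0) ->
  (forall i j, a (rshift 1 i) (rshift 1 j) + a (rshift 1 j) (rshift 1 i) =
        - 2 * iC * b0 * (hbar / (2 * m * c))%:C * (i == j)%:R) ->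
  f x = iC * b0 * (V x / (hbar * c))%:C ->
  waveop a b f Psi x = - iC * b0 * (hbar * c)^-1%:C *
   (schrodinger_lhs c hbar Psi x - schrodinger_rhs hbar m V Psi x).
Proof.
move=> c0 hbar0 m0 cPsi b0 a00 a0i bi aij fx.
have cN0 : c != 0 by rewrite gt_eqF.
have hN0 : hbar != 0 by rewrite gt_eqF.
have mN0 : m != 0 by rewrite gt_eqF.
rewrite /waveop fx /schrodinger_lhs /schrodinger_rhs /dt.
have -> : \sum_mu b mu ord0 * pd mu Psi x = b0 * pd ord0 Psi x.
  by rewrite big_event big1 ?addr0// => i _; rewrite bi mul0r.
have -> : \sum_mu \sum_nu a mu nu * pd mu (pd nu Psi) x =
    - iC * b0 * (hbar / (2 * m * c))%:C * laplacian Psi x.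
  pose h mu nu := pd mu (pd nu Psi) x.
  have hC mu nu : h mu nu = h nu mu by rewrite /h (pdC mu nu cPsi).
  have aij' i j : a (rshift 1 i) (rshift 1 j) + a (rshift 1 j) (rshift 1 i) =
      2 * (- iC * b0 * (hbar / (2 * m * c))%:C) * (i == j)%:R.
    by rewrite aij; ring.
  exact: (contraction_of_coefs hC a00 a0i aij').
have -> : hbar / (2 * m * c) = (hbar * c)^-1 * (hbar ^+ 2 / (2 * m)).
  by field; rewrite cN0 mN0 hN0.
have -> : V x / (hbar * c) = (hbar * c)^-1 * V x by rewrite mulrC.
rewrite !rmorphM/=.
have hc1 : (hbar * c)^-1%:C * hbar%:C * c%:C = 1 :> R[i].
  by rewrite -!rmorphM/= -mulrA mulVf ?mulf_neq0.
transitivity (- iC * b0 * (hbar * c)^-1%:C * (hbar ^+ 2)%:C * ((2 * m)^-1)%:C * laplacian Psi x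
  - (iC * iC) * b0 * ((hbar * c)^-1%:C * hbar%:C * c%:C) * pd ord0 Psi x
  + iC * b0 * ((hbar * c)^-1%:C * (V x)%:C) * Psi x).
  by rewrite hc1 iCM; ring.
ring.
Qed.

(** A single constant [C] serves all potentials and all C2 functions. *)
Definition schrodinger_multiple (R : realType) (c hbar m : R)
    (a : 'M[R[i]]_(1 + 3)) (b : 'cV[R[i]]_(1 + 3))
    (f : (event R -> R) -> event R -> R[i]) (C : R[i]) : Prop :=
  C != 0 /\ forall (V : event R -> R) (Psi : event R -> R[i]), C2 Psi ->
    forall x, waveop a b (f V) Psi x =
      C * (schrodinger_lhs c hbar Psi x - schrodinger_rhs hbar m V Psi x).

Lemma schrodinger_of_de_broglie (R : realType) (c hbar m : R)
    (a : 'M[R[i]]_(1 + 3)) (b : 'cV[R[i]]_(1 + 3))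
    (f : (event R -> R) -> event R -> R[i]) :
  0 < c -> 0 < hbar -> 0 < m ->
  is_wave_equation c a b f -> de_broglie c hbar m a b f ->
  exists C, schrodinger_multiple c hbar m a b f C.
Proof.
move=> c0 hbar0 m0 [tder _] [pw dispersion fV].
(* The wave that exists for [k] has the frequency given by the dispersion clause, and it vanishes
   nowhere, so the symbol of the operator is zero. *)
have disp x V0 (k : 'cV[R]_3) : k != 0 ->
    let p mu :=
      (wave_covector c k (hbar * dot k k / (2 * m) + V0 / hbar) mu)%:C in
    f (fun=> V0) x - \sum_mu \sum_nu a mu nu * (p mu * p nu) +
      iC * \sum_mu b mu ord0 * p mu = 0.
  move=> k0; have [Psi0 [omega [P0 sol]]] := pw V0 k k0.
  have E := dispersion _ _ _ _ P0 sol; rewrite -E.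
  have := sol x; rewrite waveop_plane_wave => /eqP.
  by rewrite mulf_eq0 (negbTE (plane_wave_neq0 _ _ _ _ P0)) orbF => /eqP.
(* The value of [f] may a priori vary with the event, so the lemma is applied at every [x]; the
   conclusions on [a] and [b] are read off at 0. *)
have coefs x := dispersion_coefs c0 hbar0 m0 (disp x).
have [a00 a0i bi aij _] := coefs 0.
(* All symmetrized entries [a^(0 mu)] vanish, so the time derivative required of a wave equation
   must come from [b^0]. *)
have b0 : b ord0 ord0 != 0.
  case: tder => // -[mu]; rewrite -(@fintype.splitK 1 3 mu); case: (fintype.split mu) => i /=.
    rewrite ord1 (_ : lshift 3 ord0 = ord0); last exact: val_inj.
    by rewrite a00 addr0 eqxx.
  by rewrite a0i eqxx.
exists (- iC * b ord0 ord0 * (hbar * c)^-1%:C); split.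
  rewrite !mulf_neq0 ?oppr_eq0 ?iC_neq0// eq_complex/= eqxx andbT.
  by rewrite invr_eq0 mulf_neq0// gt_eqF.
move=> V Psi cPsi x.
apply: (waveop_of_coefs c0 hbar0 m0 cPsi a00 a0i bi aij).
by rewrite fV; have [_ _ _ _ ->] := coefs x.
Qed.

(** * The free Schroedinger operator and the converse direction *)

Definition free_op (R : realType) (c hbar m : R) (Psi : event R -> R[i])
    (x : event R) : R[i] :=
  schrodinger_lhs c hbar Psi x + (hbar ^+ 2 / (2 * m))%:C * laplacian Psi x.

Lemma free_opE (R : realType) (c hbar m : R) (V : event R -> R) Psi x :
  schrodinger_lhs c hbar Psi x - schrodinger_rhs hbar m V Psi x =
  free_op c hbar m Psi x - (V x)%:C * Psi x.
Proof. rewrite /free_op /schrodinger_rhs; ring. Qed.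

Lemma laplacian_cst (R : realType) (k : R[i]) (x : event R) :
  laplacian (fun=> k) x = 0.
Proof. by rewrite /laplacian big1// => i _; rewrite !pd_cst. Qed.

Lemma laplacian_coord (R : realType) nu (x : event R) :
  laplacian (fun x => (x nu ord0)%:C) x = 0.
Proof. by rewrite /laplacian big1// => i _; rewrite pd_coord pd_cst. Qed.

Lemma free_op_cst (R : realType) (c hbar m : R) (k : R[i]) (x : event R) :
  free_op c hbar m (fun=> k) x = 0.
Proof.
by rewrite /free_op laplacian_cst /schrodinger_lhs /dt pd_cst !mulr0 addr0.
Qed.

Lemma free_op_coord (R : realType) (c hbar m : R) nu (x : event R) :
  free_op c hbar m (fun x => (x nu ord0)%:C) x =
  iC * hbar%:C * c%:C * (nu == ord0)%:R.
Proof.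
rewrite /free_op laplacian_coord /schrodinger_lhs /dt pd_coord mulr0 addr0.
by rewrite mulrA.
Qed.

Lemma free_op_plane_wave (R : realType) (c hbar m : R) (Psi0 : R[i])
    (k : 'cV[R]_3) (omega : R) (x : event R) : c != 0 ->
  free_op c hbar m (plane_wave c Psi0 k omega) x =
  (hbar * omega - hbar ^+ 2 / (2 * m) * dot k k)%:C *
  plane_wave c Psi0 k omega x.
Proof.
move=> c0; rewrite /free_op /schrodinger_lhs /dt pd_plane_wave wave_covector0.
have -> : laplacian (plane_wave c Psi0 k omega) x =
    - (dot k k)%:C * plane_wave c Psi0 k omega x.
  rewrite /laplacian /dot rmorph_sum/= -sumrN mulr_suml.
  by apply: eq_bigr => i _; rewrite pd2_plane_wave wave_covectorS.
have cw : c%:C * (- (omega / c))%:C = - omega%:C.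
  by rewrite -rmorphM -rmorphN/= mulrN mulrCA divff// mulr1.
rewrite rmorphB/= 2!rmorphM/=; set P := plane_wave _ _ _ _ _.
transitivity (iC * iC * hbar%:C * (c%:C * (- (omega / c))%:C) * P -
  (hbar ^+ 2 / (2 * m))%:C * (dot k k)%:C * P); first by ring.
by rewrite iCM cw; ring.
Qed.

Section SchrodingerMultiple.
Context (R : realType) (c hbar m : R) (c0 : 0 < c) (hbar0 : 0 < hbar) (m0 : 0 < m).
Context (a : 'M[R[i]]_(1 + 3)) (b : 'cV[R[i]]_(1 + 3)).
Context (f : (event R -> R) -> event R -> R[i]) (C : R[i]).
Context (HC : schrodinger_multiple c hbar m a b f C).

(** The test function 1 has no derivatives, so it isolates the zeroth order term. *)
Lemma f_potential V x : f V x = - C * (V x)%:C.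
Proof.
have := HC.2 V _ (C2_cst 1) x; rewrite free_opE free_op_cst /waveop.
rewrite [X in _ + X + _]big1; last first.
  by move=> mu _; rewrite pd_cst mulr0.
rewrite big1; last by move=> mu _; apply: big1 => nu _; rewrite !pd_cst mulr0.
by rewrite !add0r !mulr1 => ->; rewrite mulrN mulNr.
Qed.

(** The zeroth order coefficient [f0] is arbitrary, so that the formula also covers the function
    [f'] of the other frame, which is not given in the form [f V]. *)
Lemma waveop_free (f0 Psi : event R -> R[i]) x : C2 Psi ->
  waveop a b f0 Psi x = C * free_op c hbar m Psi x + f0 x * Psi x.
Proof.
move=> cPsi; pose V : event R -> R := fun=> 0.
transitivity (waveop a b (f V) Psi x + (f0 x - f V x) * Psi x).
  by rewrite /waveop; ring.
by rewrite HC.2// free_opE f_potential; ring.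
Qed.

(** On a plane wave the operator is multiplication by [C] times the defect of the dispersion
    relation. The equivalence provides both the existence and the dispersion clause of the de
    Broglie hypothesis. *)
Lemma plane_wave_solutionP V0 Psi0 (k : 'cV[R]_3) omega : Psi0 != 0 ->
  plane_wave_solution c a b (f (fun=> V0)) Psi0 k omega <->
  omega = hbar * dot k k / (2 * m) + V0 / hbar.
Proof.
move=> P0.
have hN0 : hbar != 0 by rewrite gt_eqF.
have mN0 : m != 0 by rewrite gt_eqF.
have cN0 : c != 0 by rewrite gt_eqF.
have E x : waveop a b (f (fun=> V0)) (plane_wave c Psi0 k omega) x =
   C * (hbar * omega - hbar ^+ 2 / (2 * m) * dot k k - V0)%:C *
   plane_wave c Psi0 k omega x.
  rewrite waveop_free; last exact: C2_plane_wave.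
  by rewrite free_op_plane_wave// f_potential !rmorphB/=; ring.
split=> [/(_ 0)|omegaE x].
  rewrite E => /eqP; rewrite mulf_eq0 (negbTE (plane_wave_neq0 _ _ _ _ P0)).
  rewrite orbF mulf_eq0 (negbTE HC.1)/= eq_complex/= eqxx andbT.
  move=> /eqP h0; apply: (mulfI hN0); apply/eqP; rewrite -subr_eq0 -h0.
  by apply/eqP; field; rewrite hN0 mN0.
rewrite E (_ : _ - V0 = 0) ?mulr0 ?mul0r// omegaE; field.
by rewrite hN0 mN0.
Qed.

Lemma schrodinger_de_broglie : de_broglie c hbar m a b f.
Proof.
split.
- move=> V0 k _; exists 1, (hbar * dot k k / (2 * m) + V0 / hbar).
  by split; [exact: oner_neq0|apply/plane_wave_solutionP; rewrite ?oner_neq0].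
- by move=> V0 Psi0 k omega P0 /(plane_wave_solutionP _ _ _ P0).
- by move=> V x; rewrite !f_potential.
Qed.

Lemma schrodinger_is_wave_equation : is_wave_equation c a b f.
Proof.
have hN0 : hbar != 0 by rewrite gt_eqF.
have mN0 : m != 0 by rewrite gt_eqF.
have cN0 : c != 0 by rewrite gt_eqF.
split.
  (* Testing on [x^0] with zeroth order coefficient 0 yields [b^0 = C i hbar c]. *)
  right; have := waveop_free (fun=> 0) 0 (C2_coord R ord0).
  rewrite free_op_coord eqxx mulr1 mul0r addr0 /waveop mul0r addr0.
  rewrite big1; last first.
    by move=> mu _; apply: big1 => nu _; rewrite pd_coord pd_cst mulr0.
  rewrite add0r big_event big1; last first.
    by move=> i _; rewrite pd_coord mulr0.
  rewrite pd_coord eqxx mulr1 addr0 => ->.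
  rewrite !mulf_neq0 ?iC_neq0 ?HC.1//; by rewrite eq_complex/= eqxx andbT.
(* A unit wave vector in zero potential has the nonzero frequency [hbar / (2 m)]. *)
pose e : 'cV[R]_3 := delta_mx ord0 ord0.
have e0 : e ord0 ord0 = 1 by rewrite mxE !eqxx.
have dote : dot e e = 1 by rewrite dot_basis e0.
exists 1, e, (hbar * dot e e / (2 * m) + 0 / hbar); split.
- exact: oner_neq0.
- by apply/eqP => /matrixP/(_ ord0 ord0); rewrite e0 mxE => /eqP; rewrite oner_eq0.
- by rewrite dote mulr1 mul0r addr0 !mulf_neq0// invr_eq0 mulf_neq0// pnatr_eq0.
- by apply/plane_wave_solutionP; rewrite ?oner_neq0.
Qed.

End SchrodingerMultiple.

(** * Galilean transformations *)

(** Keeps [x^0] and sends [r] to [x^0 w + M r]. Rotations have [w = 0]; the boost from S to S' has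
    [M = 1] and [w = - v / c], the division by [c] coming from [x^0 = ct]. *)
Definition galilei_mx (R : realType) (w : 'cV[R]_3) (M : 'M[R]_3) :
    'M[R]_(1 + 3) := block_mx 1%:M 0 w M.

Lemma galilei_mxE (R : realType) (w : 'cV[R]_3) (M : 'M[R]_3) :
  [/\ galilei_mx w M ord0 ord0 = 1,
      forall i, galilei_mx w M ord0 (rshift 1 i) = 0,
      forall i, galilei_mx w M (rshift 1 i) ord0 = w i ord0
    & forall i j, galilei_mx w M (rshift 1 i) (rshift 1 j) = M i j].
Proof.
have z : (ord0 : 'I_(1 + 3)) = lshift 3 ord0 by exact: val_inj.
rewrite z /galilei_mx; split.
- by rewrite block_mxEul mxE.
- by move=> i; rewrite block_mxEur mxE.
- by move=> i; rewrite block_mxEdl.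
- by move=> i j; rewrite block_mxEdr.
Qed.

Local Opaque galilei_mx.

Lemma event_ext (R : realType) (x y : event R) :
  x ord0 ord0 = y ord0 ord0 -> epos x = epos y -> x = y.
Proof.
move=> xy0 xyS; apply/colP => mu; rewrite -(@fintype.splitK 1 3 mu).
case: (fintype.split mu) => i /=.
  by rewrite ord1 (_ : lshift 3 ord0 = ord0)//; exact: val_inj.
by have /colP/(_ i) := xyS; rewrite !mxE.
Qed.

Lemma galilei_mx_time (R : realType) (w : 'cV[R]_3) (M : 'M[R]_3) (x : event R) :
  (galilei_mx w M *m x) ord0 ord0 = x ord0 ord0.
Proof.
have [L00 L0i _ _] := galilei_mxE w M.
rewrite mxE big_event L00 mul1r big1 ?addr0// => i _.
by rewrite L0i mul0r.
Qed.

Lemma galilei_mx_pos (R : realType) (w : 'cV[R]_3) (M : 'M[R]_3) (x : event R) :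
  epos (galilei_mx w M *m x) = x ord0 ord0 *: w + M *m epos x.
Proof.
have [_ _ Li0 Lij] := galilei_mxE w M.
apply/colP => i; rewrite !mxE big_event Li0 mulrC; congr (_ + _).
by apply: eq_bigr => j _; rewrite Lij mxE.
Qed.

Lemma rotation_framesP (R : realType) (c : R) (M : 'M[R]_3) (x x' : event R) :
  c != 0 -> rotation_frames c M x x' <-> x' = galilei_mx 0 M *m x.
Proof.
move=> c0; split=> [[pos time]|->].
  apply: event_ext; last by rewrite galilei_mx_pos scaler0 add0r.
  by rewrite galilei_mx_time; apply: (mulIf (invr_neq0 c0)).
rewrite /rotation_frames galilei_mx_pos scaler0 add0r; split=> //.
by rewrite /etime galilei_mx_time.
Qed.

Lemma boost_framesP (R : realType) (c : R) (v : 'cV[R]_3) (x x' : event R) :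
  c != 0 -> boost_frames c v x x' <-> x' = galilei_mx (- c^-1 *: v) 1%:M *m x.
Proof.
move=> c0; split=> [[time pos]|->].
  have time0 : x ord0 ord0 = x' ord0 ord0 := mulIf (invr_neq0 c0) time.
  apply: event_ext; first by rewrite galilei_mx_time.
  rewrite galilei_mx_pos mul1mx pos /etime time0 addrC -addrA scalerA -scalerDl.
  by rewrite mulrN subrr scale0r addr0.
rewrite /boost_frames /etime galilei_mx_time galilei_mx_pos mul1mx; split=> //.
by rewrite scalerA addrAC -scalerDl mulrN addNr scale0r add0r.
Qed.

Lemma boost_mxK (R : realType) (w : 'cV[R]_3) (x : event R) :
  galilei_mx w 1%:M *m (galilei_mx (- w) 1%:M *m x) = x.
Proof.
apply: event_ext; rewrite ?galilei_mx_time// !galilei_mx_pos !mul1mx.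
by rewrite galilei_mx_time scalerN addNKr.
Qed.

(** The new time does not depend on the old position, so only the block [M] enters second spatial
    derivatives, and orthogonality of its rows contracts them to the Laplacian. *)
Lemma laplacian_galilei (R : realType) (w : 'cV[R]_3) (M : 'M[R]_3)
    (Psi : event R -> R[i]) (x : event R) :
  C2 Psi -> M *m M^T = 1%:M ->
  laplacian (fun y => Psi (galilei_mx w M *m y)) x =
  laplacian Psi (galilei_mx w M *m x).
Proof.
move=> cPsi MMT; have [_ L0i _ Lij] := galilei_mxE w M.
rewrite /laplacian; move: (galilei_mx w M) L0i Lij => L L0i Lij.
set y := L *m x.
pose H al be := pd be (pd al Psi) y.
transitivity (\sum_(i < 3) \sum_(j < 3) \sum_(k < 3)
    (M j i)%:C * (M k i)%:C * H (rshift 1 j) (rshift 1 k)).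
  apply: eq_bigr => i _; rewrite (pd2_comp_mulmx _ _ _ cPsi) big_event.
  rewrite [X in X + _]big1; last by move=> be _; rewrite L0i !mul0r.
  rewrite add0r; apply: eq_bigr => j _; rewrite big_event L0i mulr0 mul0r add0r.
  by apply: eq_bigr => k _; rewrite !Lij.
rewrite exchange_big/=; apply: eq_bigr => j _; rewrite exchange_big/=.
have MM k : \sum_(i < 3) (M j i)%:C * (M k i)%:C = (j == k)%:R :> R[i].
  have /matrixP/(_ j k) := MMT; rewrite !mxE => /(congr1 (fun z : R => z%:C)).
  rewrite rmorph_sum rmorph_nat/= => <-.
  by apply: eq_bigr => i _; rewrite mxE rmorphM.
under eq_bigr do rewrite -mulr_suml MM.
rewrite (bigD1 j)//= eqxx mul1r big1 ?addr0// => k /negbTE kj.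
by rewrite eq_sym kj mul0r.
Qed.

(** The Laplacian is invariant; the extra convective term arises because the new position depends on
    the old time through [w]. *)
Lemma free_op_galilei (R : realType) (c hbar m : R) (w : 'cV[R]_3) (M : 'M[R]_3)
    (Psi : event R -> R[i]) (x : event R) :
  C2 Psi -> M *m M^T = 1%:M -> let y := galilei_mx w M *m x in
  free_op c hbar m (fun z => Psi (galilei_mx w M *m z)) x =
  free_op c hbar m Psi y +
  iC * hbar%:C * c%:C * \sum_(j < 3) (w j ord0)%:C * pd (rshift 1 j) Psi y.
Proof.
move=> cPsi MMT y; have [L00 L0i Li0 Lij] := galilei_mxE w M.
rewrite /free_op /schrodinger_lhs /dt (laplacian_galilei _ _ cPsi MMT).
rewrite (pd_comp_mulmx _ _ (C2_cdiff cPsi)) -/y big_event L00.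
under eq_bigr do rewrite Li0.
rewrite rmorph1; ring.
Qed.

(** * Action of a boost on a product [g Psi'] *)

Lemma free_opM (R : realType) (c hbar m : R) (g Psi : event R -> R[i])
    (y : event R) : C2 g -> C2 Psi ->
  free_op c hbar m (fun z => g z * Psi z) y =
  g y * free_op c hbar m Psi y + free_op c hbar m g y * Psi y +
  2 * (hbar ^+ 2 / (2 * m))%:C *
    \sum_(j < 3) pd (rshift 1 j) g y * pd (rshift 1 j) Psi y.
Proof.
move=> cg cPsi; rewrite /free_op /schrodinger_lhs /dt.
rewrite (pdM _ (C2_cdiff cg) (C2_cdiff cPsi)).
have -> : laplacian (fun z => g z * Psi z) y =
  laplacian g y * Psi y + g y * laplacian Psi y +
  2 * \sum_(j < 3) pd (rshift 1 j) g y * pd (rshift 1 j) Psi y.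
  rewrite /laplacian mulr_suml !mulr_sumr -!big_split/=.
  apply: eq_bigr => j _; rewrite (pd2M _ _ cg cPsi).
  move: (pd _ (pd _ g) y) (pd _ (pd _ Psi) y) (pd _ g y) (pd _ Psi y).
  by move=> g2 Psi2 g1 Psi1; ring.
move: (laplacian g y) (laplacian Psi y) (pd _ g y) (pd _ Psi y) (\sum_(_ < 3) _).
by move=> g2 Psi2 g1 Psi1 s; ring.
Qed.

(* The zeroth and first order coefficients produced by a boost, once the
   factor [g] has been pulled out of the transformed operator. *)
Definition boost_drift (R : realType) (c hbar m : R) (v : 'cV[R]_3)
    (g : event R -> R[i]) (y : event R) : R[i] :=
  free_op c hbar m g y -
  iC * hbar%:C * \sum_(j < 3) (v j ord0)%:C * pd (rshift 1 j) g y.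

Definition boost_shear (R : realType) (hbar m : R) (v : 'cV[R]_3)
    (g : event R -> R[i]) (j : 'I_3) (y : event R) : R[i] :=
  (hbar ^+ 2 / m)%:C * pd (rshift 1 j) g y - iC * hbar%:C * (v j ord0)%:C * g y.

(** For [w = - v / c] the convective term is [- i hbar v . grad (g Psi)]. Its part with [grad g]
    enters the drift; its part with [grad Psi] joins the Leibniz cross term of the Laplacian to form
    the shears. *)
Lemma free_op_boost (R : realType) (c hbar m : R) (v : 'cV[R]_3)
    (g Psi : event R -> R[i]) (x : event R) : c != 0 -> C2 g -> C2 Psi ->
  let L := galilei_mx (- c^-1 *: v) 1%:M in let y := L *m x in
  free_op c hbar m (fun z => g (L *m z) * Psi (L *m z)) x =
  g y * free_op c hbar m Psi y + boost_drift c hbar m v g y * Psi y +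
  \sum_(j < 3) boost_shear hbar m v g j y * pd (rshift 1 j) Psi y.
Proof.
move=> c0 cg cPsi L y; have cgP := C2M cg cPsi.
rewrite (@free_op_galilei _ c hbar m _ _ (fun z => g z * Psi z))//; last first.
  by rewrite trmx1 mulmx1.
rewrite (free_opM _ _ _ _ cg cPsi) -/L -/y /boost_drift.
set A := \sum_(j < 3) _ * _; set Bv := \sum_(j < 3) _ * pd _ g y.
pose Cv := \sum_(j < 3) (v j ord0)%:C * pd (rshift 1 j) Psi y.
have cV : c%:C * c^-1%:C = 1 :> R[i] by rewrite -rmorphM divff.
have K2 : (hbar ^+ 2 / m)%:C = 2 * (hbar ^+ 2 / (2 * m))%:C.
  rewrite -[2]/(2%:R) -(rmorph_nat (real_complex R)) -rmorphM/=; congr (_%:C).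
  by rewrite invfM mulrCA mulVKf// pnatr_eq0.
have -> : \sum_(j < 3) ((- c^-1 *: v) j ord0)%:C *
    pd (rshift 1 j) (fun z => g z * Psi z) y =
    - c^-1%:C * (Bv * Psi y + g y * Cv).
  rewrite /Bv /Cv mulr_suml !mulr_sumr -big_split/= mulr_sumr.
  apply: eq_bigr => j _; rewrite (pdM _ (C2_cdiff cg) (C2_cdiff cPsi)) mxE.
  rewrite rmorphM rmorphN/=.
  by move: (pd _ g y) (pd _ Psi y) => g1 Psi1; ring.
have -> : \sum_(j < 3) boost_shear hbar m v g j y * pd (rshift 1 j) Psi y =
    (hbar ^+ 2 / m)%:C * A - iC * hbar%:C * g y * Cv.
  rewrite /A /Cv !mulr_sumr -sumrB; apply: eq_bigr => j _; rewrite /boost_shear.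
  by move: (pd _ g y) (pd _ Psi y) => g1 Psi1; ring.
rewrite K2; move: (free_op _ _ _ g y) (free_op _ _ _ Psi y) A Bv Cv => g2 Psi2 A B1 B2.
transitivity (g y * Psi2 + g2 * Psi y + 2 * (hbar ^+ 2 / (2 * m))%:C * A -
  iC * hbar%:C * (c%:C * c^-1%:C) * (B1 * Psi y + g y * B2)); first by ring.
by rewrite cV; ring.
Qed.

(** * The boost factor as the solution of the drift and shear conditions *)

Lemma wave_covectorN (R : realType) (c : R) (k : 'cV[R]_3) (omega : R) mu :
  wave_covector c (- k) (- omega) mu = - wave_covector c k omega mu.
Proof.
rewrite -(@fintype.splitK 1 3 mu); case: (fintype.split mu) => i /=.
  rewrite ord1 (_ : lshift 3 ord0 = ord0); last exact: val_inj.
  by rewrite !wave_covector0 mulNr.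
by rewrite !wave_covectorS mxE.
Qed.

Lemma expiNM (R : realType) (t : R) : expi (- t) * expi t = 1.
Proof.
apply/eqP; rewrite eq_complex complexReM complexImM/= cosN sinN.
have := cos2Dsin2 t => cs; apply/andP; split; apply/eqP; last by ring.
by rewrite -cs; ring.
Qed.

Lemma plane_waveNM (R : realType) (c : R) (k : 'cV[R]_3) (omega : R) x :
  plane_wave c 1 (- k) (- omega) x * plane_wave c 1 k omega x = 1.
Proof.
rewrite /plane_wave !mul1r -[RHS](expiNM (dot k (epos x) - omega * etime c x)).
congr (expi _ * _).
have -> : dot (- k) (epos x) = - dot k (epos x).
  by rewrite /dot -sumrN; apply: eq_bigr => i _; rewrite mxE mulNr.
ring.
Qed.

(** The product of [g] with the reciprocal plane wave has zero gradient, hence is constant. *)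
Lemma plane_wave_unique (R : realType) (c : R) (k : 'cV[R]_3) (omega : R)
    (g : event R -> R[i]) : cdiff g ->
  (forall mu x, pd mu g x = iC * (wave_covector c k omega mu)%:C * g x) ->
  exists kappa, g = plane_wave c kappa k omega.
Proof.
move=> dg Dg; pose q := plane_wave c 1 (- k) (- omega).
have dq : cdiff q := C2_cdiff (C2_plane_wave _ _ _ _).
exists (g 0 * q 0); apply/funext => x.
rewrite /plane_wave -[expi _]mul1r -/(plane_wave c 1 k omega x).
have <- : g x * q x = g 0 * q 0.
  apply: (pd0_cst (cdiffM dg dq)) => mu y.
  rewrite (pdM _ dg dq) Dg pd_plane_wave wave_covectorN rmorphN/= -/q.
  by ring.
by rewrite -mulrA plane_waveNM mulr1.
Qed.

(** The de Broglie wave vector of a particle of velocity [v]. *)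
Definition boost_wavevector (R : realType) (hbar m : R) (v : 'cV[R]_3) :=
  (m / hbar) *: v.

(** Minus the kinetic energy over [hbar]: the phase of [boost_factor] grows with [t'], whereas a
    plane wave carries [- omega t]. *)
Definition boost_omega (R : realType) (hbar m : R) (v : 'cV[R]_3) : R :=
  - (m * dot v v / (2 * hbar)).

Lemma boost_factorE (R : realType) (c hbar m : R) (v : 'cV[R]_3) kappa :
  (fun x => kappa * boost_factor c hbar m v x) =
  plane_wave c kappa (boost_wavevector hbar m v) (boost_omega hbar m v).
Proof.
apply/funext => x; rewrite /boost_factor /plane_wave; congr (_ * expi _).
have -> : dot (boost_wavevector hbar m v) (epos x) = m / hbar * dot v (epos x).
  by rewrite /dot mulr_sumr; apply: eq_bigr => i _; rewrite mxE mulrA.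
rewrite /boost_omega invfM; ring.
Qed.

Lemma dot_boost_wavevector (R : realType) (hbar m : R) (v : 'cV[R]_3) :
  dot (boost_wavevector hbar m v) (boost_wavevector hbar m v) =
  (m / hbar) ^+ 2 * dot v v.
Proof. exact: dotZ. Qed.

Lemma sum_velocity_gradient (R : realType) (v : 'cV[R]_3) (s : R)
    (z : R[i]) (p : 'I_3 -> R[i]) :
  (forall j, p j = iC * s%:C * (v j ord0)%:C * z) ->
  \sum_(j < 3) (v j ord0)%:C * p j = iC * (s * dot v v)%:C * z.
Proof.
move=> pE; transitivity (iC * s%:C * z * \sum_(j < 3) (v j ord0 * v j ord0)%:C).
  by rewrite mulr_sumr; apply: eq_bigr => j _; rewrite pE rmorphM/=; ring.
by rewrite rmorphM /dot rmorph_sum/=; ring.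
Qed.

(** In the drift the free operator has eigenvalue [- m v^2], half from the frequency and half from
    the wave vector, and the velocity gradient contributes [+ m v^2]. *)
Lemma boost_coefs_plane_wave (R : realType) (c hbar m : R) (v : 'cV[R]_3) kappa :
  c != 0 -> hbar != 0 -> m != 0 ->
  let g := plane_wave c kappa (boost_wavevector hbar m v) (boost_omega hbar m v) in
  (forall y, boost_drift c hbar m v g y = 0) /\
  (forall j y, boost_shear hbar m v g j y = 0).
Proof.
move=> c0 hbar0 m0 g; have dg j y : pd (rshift 1 j) g y =
    iC * (m / hbar)%:C * (v j ord0)%:C * g y.
  by rewrite /g pd_plane_wave wave_covectorS mxE rmorphM/= [iC * (_ * _)]mulrA.
split=> [y|j y].
  rewrite /boost_drift (free_op_plane_wave _ _ _ _ _ _ c0) -/g.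
  have -> : \sum_(j < 3) (v j ord0)%:C * pd (rshift 1 j) g y =
      iC * (m / hbar * dot v v)%:C * g y.
    exact: (sum_velocity_gradient (fun j => dg j y)).
  rewrite dot_boost_wavevector /boost_omega.
  have -> : hbar * - (m * dot v v / (2 * hbar)) -
     hbar ^+ 2 / (2 * m) * ((m / hbar) ^+ 2 * dot v v) =
     - (hbar * (m / hbar * dot v v)) by field; rewrite hbar0 m0.
  rewrite rmorphN rmorphM/=; set z := (m / hbar * _)%:C.
  transitivity (- (1 + iC * iC) * hbar%:C * z * g y); first by ring.
  by rewrite iCM; ring.
rewrite /boost_shear dg.
have h : (hbar ^+ 2 / m)%:C * (m / hbar)%:C = hbar%:C :> R[i].
  by rewrite -rmorphM/=; congr (_%:C); field; rewrite hbar0 m0.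
transitivity (((hbar ^+ 2 / m)%:C * (m / hbar)%:C - hbar%:C) * iC * (v j ord0)%:C * g y).
  by ring.
by rewrite h subrr !mul0r.
Qed.

(** Vanishing shears fix the spatial gradient of [g], hence its Laplacian; vanishing drift then
    fixes the time derivative, and a function with this logarithmic gradient is a plane wave. *)
Lemma boost_coefs_solution (R : realType) (c hbar m : R) (v : 'cV[R]_3)
    (g : event R -> R[i]) :
  c != 0 -> hbar != 0 -> m != 0 -> C2 g ->
  (forall y, boost_drift c hbar m v g y = 0) ->
  (forall j y, boost_shear hbar m v g j y = 0) ->
  exists kappa,
    g = plane_wave c kappa (boost_wavevector hbar m v) (boost_omega hbar m v).
Proof.
move=> c0 hbar0 m0 cg drift0 shear0.
have dg j y : pd (rshift 1 j) g y = iC * (m / hbar * v j ord0)%:C * g y.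
  have h : (m / hbar ^+ 2)%:C * (hbar ^+ 2 / m)%:C = 1 :> R[i].
    by rewrite -rmorphM/= mulrA mulfVK ?expf_neq0// divff.
  have h' : m / hbar * v j ord0 = m / hbar ^+ 2 * (hbar * v j ord0).
    by field; rewrite hbar0.
  have -> : (m / hbar * v j ord0)%:C =
      (m / hbar ^+ 2)%:C * (hbar%:C * (v j ord0)%:C) :> R[i].
    by rewrite h' rmorphM; congr (_ * _); rewrite rmorphM.
  rewrite -[LHS]mul1r -h.
  move/eqP: (shear0 j y); rewrite /boost_shear subr_eq0 => /eqP E.
  by rewrite -mulrA E; ring.
apply: plane_wave_unique; first exact: C2_cdiff.
move=> mu y; rewrite -(@fintype.splitK 1 3 mu); case: (fintype.split mu) => i /=.
  rewrite ord1 (_ : lshift 3 ord0 = ord0); last exact: val_inj.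
  rewrite wave_covector0.
  have lap : laplacian g y = - ((m / hbar) ^+ 2 * dot v v)%:C * g y.
    rewrite /laplacian -dotZ /dot rmorph_sum/= -sumrN mulr_suml.
    apply: eq_bigr => l _; pose z : R[i] := (m / hbar * v l ord0)%:C.
    have -> : pd (rshift 1 l) g = fun y => iC * z * g y.
      by apply/funext => u; exact: dg.
    rewrite (pdZ _ _ (C2_cdiff cg)) dg -/z mxE.
    have -> : (m / hbar * v l ord0 * (m / hbar * v l ord0))%:C = z * z :> R[i].
      by rewrite rmorphM.
    transitivity ((iC * iC) * z * z * g y); first by ring.
    by rewrite iCM; ring.
  have sumv : \sum_(j < 3) (v j ord0)%:C * pd (rshift 1 j) g y =
      iC * (m / hbar * dot v v)%:C * g y.
    by apply: sum_velocity_gradient => j; rewrite dg rmorphM/= [iC * (_ * _)]mulrA.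
  move: (drift0 y); rewrite /boost_drift /free_op /schrodinger_lhs /dt lap sumv.
  set p := pd ord0 g y => E.
  (* In the drift the Laplacian gives [- m v^2 / 2] and the velocity gradient [+ m v^2]; the
     remainder balances the time derivative. *)
  have E' : iC * (hbar * c)%:C * p = - (m * dot v v / 2)%:C * g y.
    have h : (hbar ^+ 2 / (2 * m))%:C * ((m / hbar) ^+ 2 * dot v v)%:C =
        (m * dot v v / 2)%:C :> R[i].
      by rewrite -rmorphM/=; congr (_%:C); field; rewrite hbar0 m0.
    have h' : hbar%:C * (m / hbar * dot v v)%:C = 2 * (m * dot v v / 2)%:C :> R[i].
      rewrite -(rmorph_nat (real_complex R) 2) -!rmorphM/=; congr (_%:C).
      by field; rewrite hbar0.
    apply/eqP; rewrite -subr_eq0 -E rmorphM/=.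
    apply/eqP; transitivity (iC * hbar%:C * (c%:C * p) +
      (hbar ^+ 2 / (2 * m))%:C * (- ((m / hbar) ^+ 2 * dot v v)%:C * g y) +
      ((hbar ^+ 2 / (2 * m))%:C * ((m / hbar) ^+ 2 * dot v v)%:C +
       (m * dot v v / 2)%:C) * g y); first by ring.
    rewrite h; transitivity (iC * hbar%:C * (c%:C * p) +
      (hbar ^+ 2 / (2 * m))%:C * (- ((m / hbar) ^+ 2 * dot v v)%:C * g y) -
      (iC * iC) * (2 * (m * dot v v / 2)%:C) * g y); first by rewrite iCM; ring.
    by rewrite -h'; ring.
  have hc0 : iC * (hbar * c)%:C != 0 :> R[i].
    by rewrite mulf_neq0 ?iC_neq0// eq_complex/= eqxx andbT mulf_neq0.
  apply: (mulfI hc0); rewrite E' /boost_omega.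
  have -> : (m * dot v v / 2)%:C =
      (hbar * c)%:C * (- (- (m * dot v v / (2 * hbar)) / c))%:C :> R[i].
    by rewrite -rmorphM/=; congr (_%:C); field; rewrite hbar0 c0.
  transitivity ((iC * iC) * (hbar * c)%:C *
    (- (- (m * dot v v / (2 * hbar)) / c))%:C * g y); first by rewrite iCM; ring.
  ring.
by rewrite wave_covectorS mxE dg.
Qed.

(** * Covariance of the Schroedinger equation and its boost law *)

Section Covariance.
Context (R : realType) (c hbar m : R) (c0 : 0 < c) (hbar0 : 0 < hbar) (m0 : 0 < m).
Context (a : 'M[R[i]]_(1 + 3)) (b : 'cV[R[i]]_(1 + 3)).
Context (f : (event R -> R) -> event R -> R[i]) (C : R[i]).
Context (HC : schrodinger_multiple c hbar m a b f C).

Let c_neq0 : c != 0. Proof. by rewrite gt_eqF. Qed.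
Let hbar_neq0 : hbar != 0. Proof. by rewrite gt_eqF. Qed.
Let m_neq0 : m != 0. Proof. by rewrite gt_eqF. Qed.

Lemma schrodinger_rotation V (M : 'M[R]_3) : is_rotation M ->
  form_invariant (rotation_frames c M) (fun=> 1) a b (f V).
Proof.
move=> [MTM _]; have MMT := mulmx1C MTM.
exists (fun=> 1); split=> [_|f' Psi Psi' cPsi' Hf HPsi x x' fr].
  exact: oner_neq0.
have PsiE : Psi = fun z => Psi' (galilei_mx 0 M *m z).
  apply/funext => z; rewrite (HPsi z (galilei_mx 0 M *m z)) ?mul1r//.
  exact/rotation_framesP.
have fE := Hf _ _ fr; move/(rotation_framesP _ _ _ c_neq0): fr fE => -> fE.
have cL := C2_comp_mulmx (galilei_mx 0 M) cPsi'.
rewrite mul1r PsiE (waveop_free HC _ _ cL) (waveop_free HC _ _ cPsi').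
rewrite (@free_op_galilei _ c hbar m 0 M Psi' x cPsi' MMT) fE.
by rewrite big1 ?mulr0 ?addr0// => j _; rewrite mxE mul0r.
Qed.

Lemma waveop_boost (f0 g Psi : event R -> R[i]) (v : 'cV[R]_3) x :
  C2 g -> C2 Psi ->
  let L := galilei_mx (- c^-1 *: v) 1%:M in let y := L *m x in
  waveop a b f0 (fun z => g (L *m z) * Psi (L *m z)) x =
  C * (g y * free_op c hbar m Psi y + boost_drift c hbar m v g y * Psi y +
    \sum_(j < 3) boost_shear hbar m v g j y * pd (rshift 1 j) Psi y) +
  f0 x * (g y * Psi y).
Proof.
move=> cg cPsi L y.
rewrite (waveop_free HC _ _ (C2_comp_mulmx L (C2M cg cPsi))).
by rewrite (free_op_boost hbar m v x c_neq0 cg cPsi).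
Qed.

Lemma boost_law_of_coefs V v g : (forall x', g x' != 0) -> C2 g ->
  (forall y, boost_drift c hbar m v g y = 0) ->
  (forall j y, boost_shear hbar m v g j y = 0) ->
  boost_law c a b (f V) v g.
Proof.
move=> g0 cg drift0 shear0; split=> //; exists g; split=> //.
move=> f' Psi Psi' cPsi' Hf HPsi x x' fr.
pose L := galilei_mx (- c^-1 *: v) 1%:M.
have PsiE : Psi = fun z => g (L *m z) * Psi' (L *m z).
  by apply/funext => z; rewrite (HPsi z (L *m z))//; exact/boost_framesP.
have fE := Hf _ _ fr; move/(boost_framesP _ _ _ c_neq0): fr fE => -> fE.
rewrite PsiE (waveop_boost _ _ _ cg cPsi') drift0 (waveop_free HC _ _ cPsi') fE.
rewrite big1 => [|j _]; last by rewrite shear0 mul0r.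
by rewrite -/L; ring.
Qed.

(** Form invariance is an identity in [Psi'], [grad Psi'] and the free operator of [Psi']; three
    kinds of test functions separate its coefficients. *)
Lemma coefs_of_boost_law V v g : boost_law c a b (f V) v g ->
  (forall y, boost_drift c hbar m v g y = 0) /\
  (forall j y, boost_shear hbar m v g j y = 0).
Proof.
move=> [g0 cg [lam [lam0 inv]]].
pose L := galilei_mx (- c^-1 *: v) 1%:M.
pose Li := galilei_mx (- (- c^-1 *: v)) 1%:M.
have LK (x : event R) : Li *m (L *m x) = x.
  by have := boost_mxK (- (- c^-1 *: v)) x; rewrite opprK.
have LiK (y : event R) : L *m (Li *m y) = y by exact: boost_mxK.
(* The strict scalar [f V] written in the coordinates of S'; it serves as [f']. *)
pose F (y : event R) := f V (Li *m y).
have key (Psi : event R -> R[i]) (y : event R) : C2 Psi ->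
    C * (g y * free_op c hbar m Psi y + boost_drift c hbar m v g y * Psi y +
      \sum_(j < 3) boost_shear hbar m v g j y * pd (rshift 1 j) Psi y) +
    F y * (g y * Psi y) =
    lam y * (C * free_op c hbar m Psi y + F y * Psi y).
  move=> cPsi.
  have := inv F (fun z => g (L *m z) * Psi (L *m z)) Psi cPsi.
  move=> /(_ _ _ (Li *m y) y); rewrite (waveop_boost _ _ _ cg cPsi) -/L LiK (waveop_free HC _ _ cPsi).
  apply.
  - by move=> x x' /(boost_framesP _ _ _ c_neq0) ->; rewrite /F LK.
  - by move=> x x' /(boost_framesP _ _ _ c_neq0) ->.
  - by apply/boost_framesP => //; rewrite LiK.
(* The test function 1 leaves only zeroth order terms. *)
have drift_lam y : C * boost_drift c hbar m v g y + F y * g y = lam y * F y.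
  have := key _ y (C2_cst 1); rewrite free_op_cst big1 => [|j _].
    by rewrite !mulr0 !mulr1 add0r addr0 add0r.
  by rewrite pd_cst mulr0.
(* On [x^0] the shears drop out and the free operator gives the nonzero constant [i hbar c]; the
   terms proportional to [x^0] cancel by [drift_lam]. *)
have lamE y : lam y = g y.
  have := key _ y (C2_coord R ord0); rewrite free_op_coord eqxx mulr1.
  rewrite big1 => [|j _]; last by rewrite pd_coord mulr0.
  set t := (y ord0 ord0)%:C; set z := iC * hbar%:C * c%:C => E.
  have Cz : C * z != 0.
    by rewrite /z !mulf_neq0 ?HC.1 ?iC_neq0// eq_complex/= eqxx andbT.
  apply: (mulIf Cz); apply/eqP; rewrite -subr_eq0; apply/eqP.
  transitivity (lam y * (C * z + F y * t) - lam y * F y * t - g y * (C * z)).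
    by ring.
  by rewrite -E -drift_lam; ring.
split=> [y|j y]; apply: (mulfI HC.1); rewrite mulr0.
  by move: (drift_lam y); rewrite lamE [g y * _]mulrC => /eqP; rewrite -subr_eq0 addrK => /eqP.
(* On [x^j] the free operator vanishes and only the shear of index [j] survives, again up to terms
   cancelled by [drift_lam]. *)
have := key _ y (C2_coord R (rshift 1 j)); rewrite free_op_coord/= !mulr0.
rewrite (bigD1 j)//= pd_coord eqxx mulr1 big1 => [|i /negbTE ij]; last first.
  by rewrite pd_coord eq_sym (inj_eq (@rshift_inj _ _)) ij mulr0.
set t := (y _ _)%:C => E.
transitivity (lam y * (0 + F y * t) - lam y * F y * t); last by ring.
by rewrite -E -drift_lam; ring.
Qed.

(** Drift and shears are linear in [g], which leaves the constant [kappa] free; it is nonzero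
    because [g] vanishes nowhere. *)
Lemma boost_lawP V v g : boost_law c a b (f V) v g <->
  exists kappa : R[i], kappa != 0 /\
    forall x', g x' = kappa * boost_factor c hbar m v x'.
Proof.
split=> [law|[kappa [kappa0 gE]]].
  have [g0 cg _] := law; have [drift0 shear0] := coefs_of_boost_law law.
  have [kappa gE] := boost_coefs_solution c_neq0 hbar_neq0 m_neq0 cg drift0 shear0.
  have gx x : g x = kappa * boost_factor c hbar m v x.
    by rewrite gE -boost_factorE.
  exists kappa; split=> //.
  by have := g0 0; rewrite gx mulf_eq0 negb_or => /andP[].
have {}gE : g = plane_wave c kappa (boost_wavevector hbar m v) (boost_omega hbar m v).
  by rewrite -boost_factorE; apply/funext.
rewrite gE.
have [drift0 shear0] :=
  @boost_coefs_plane_wave _ c hbar m v kappa c_neq0 hbar_neq0 m_neq0.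
apply: boost_law_of_coefs => //; last exact: C2_plane_wave.
by move=> x; exact: plane_wave_neq0.
Qed.

Lemma schrodinger_covariant V : galilean_covariant c a b (f V).
Proof.
split=> [M|v]; first exact: schrodinger_rotation.
exists (boost_factor c hbar m v); apply/boost_lawP; exists 1.
by split=> [|x]; rewrite ?oner_neq0 ?mul1r.
Qed.

End Covariance.

(** * Equivalence with the Schroedinger equation and determination of the boost factor *)

Unset Implicit Arguments.

Theorem mainTheorem1 (R : realType) (c hbar m : R)
    (c_gt0 : 0 < c) (hbar_gt0 : 0 < hbar) (m_gt0 : 0 < m)
    (a : 'M[R[i]]_(1 + 3)) (b : 'cV[R[i]]_(1 + 3))
    (f : (event R -> R) -> event R -> R[i]) :
  ([/\ is_wave_equation c a b f,
       forall V, galilean_covariant c a b (f V)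
     & de_broglie c hbar m a b f] <->
   exists C : R[i], C != 0 /\
     forall (V : event R -> R) (Psi : event R -> R[i]), C2 Psi ->
     forall x, waveop a b (f V) Psi x =
       C * (schrodinger_lhs c hbar Psi x - schrodinger_rhs hbar m V Psi x)) /\
  ([/\ is_wave_equation c a b f,
       forall V, galilean_covariant c a b (f V)
     & de_broglie c hbar m a b f] ->
   forall (V : event R -> R) (v : 'cV[R]_3) (g : event R -> R[i]),
     boost_law c a b (f V) v g <->
     exists kappa : R[i], kappa != 0 /\
       forall x', g x' = kappa * boost_factor c hbar m v x').
Proof.
have schrodinger := @schrodinger_of_de_broglie R c hbar m a b f c_gt0 hbar_gt0 m_gt0.
split; first split.
- by move=> [wave _ broglie]; exact: schrodinger.
- move=> [C HC]; split.
  + exact: (schrodinger_is_wave_equation c_gt0 hbar_gt0 m_gt0 HC).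
  + exact: (schrodinger_covariant c_gt0 hbar_gt0 m_gt0 HC).
  + exact: (schrodinger_de_broglie c_gt0 hbar_gt0 m_gt0 HC).
- move=> [wave _ broglie] V v g; have [C HC] := schrodinger wave broglie.
  exact: (boost_lawP c_gt0 hbar_gt0 m_gt0 HC).
Qed.
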